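(* For every integer $\ell>3$ there are no faithful uniserial $\mathfrak g$-modules of length $\ell$.
   Context: $\mathbb F$ is a field of characteristic zero; all Lie algebras and modules are finite dimensional over $\mathbb F$. $\mathfrak h_n$ ($n\ge1$) is the Heisenberg Lie algebra of dimension $2n+1$, with one-dimensional center $\mathfrak z$ and $[\mathfrak h_n,\mathfrak h_n]=\mathfrak z$; $m=2n-1$. $\mathfrak{sl}(2)$ acts on $\mathfrak h_n$ by derivations so that $\mathfrak h_n\cong V(m)\oplus\mathfrak z$ as $\mathfrak{sl}(2)$-modules, where $V(a)$ is the irreducible $\mathfrak{sl}(2)$-module of highest weight $a$ and $\mathfrak z\cong V(0)$. $\mathfrak g=\mathfrak{sl}(2)\ltimes\mathfrak h_n$. A $\mathfrak g$-module $V$ is uniserial of length $\ell$ if its socle series $0=\mathrm{soc}^0(V)\subset\cdots\subset\mathrm{soc}^\ell(V)=V$ (with $\mathrm{soc}^i/\mathrm{soc}^{i-1}$ the socle, i.e. sum of irreducible submodules, of $V/\mathrm{soc}^{i-1}$) has all factors irreducible. Faithful means the representation $\mathfrak g\to\mathfrak{gl}(V)$ is injective. *)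

(* Defs.v *)
From HB Require Import structures.
From mathcomp Require Import all_boot all_order all_algebra.
Set Implicit Arguments. Unset Strict Implicit. Unset Printing Implicit Defensive.
Import Order.TTheory GRing.Theory Num.Theory.
Local Open Scope ring_scope.

(* Lie algebra g = sl(2) |x h_n, m = 2n-1, with basis
     e, h, f  (sl(2)),   x_0, ..., x_m  (V(m)),   z  (center of h_n).
   Brackets (all others zero, up to antisymmetry):
     [h,e] = 2e, [h,f] = -2f, [e,f] = h,
     [h,x_k] = (m-2k) x_k, [e,x_k] = k x_(k-1), [f,x_k] = (m-k) x_(k+1),
     [x_i,x_j] = (if i+j = m then (-1)^i i! (m-i)! else 0) z.
   A g-module of dimension d is given by the matrices E, H, Fm, X k (k < 2n), Z
   representing e, h, f, x_k, z, acting on column vectors of F^d, so that the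
   bracket is sent to the matrix commutator. *)

Section Defs.
Variable F : fieldType.

Definition lie d (A B : 'M[F]_d) : 'M[F]_d := A *m B - B *m A.

Definition hcoef (n i : nat) : F :=
  (-1) ^+ i * (i`!)%:R * (((2 * n).-1 - i)`!)%:R.

Definition gmodule (n d : nat) (E H Fm : 'M[F]_d) (X : nat -> 'M[F]_d)
    (Z : 'M[F]_d) : Prop :=
  let m := (2 * n).-1 in
  [/\ [/\ lie H E = 2%:R *: E, lie H Fm = - (2%:R *: Fm) & lie E Fm = H],
      (forall k, (k < 2 * n)%N ->
        [/\ lie H (X k) = (m%:R - (2 * k)%:R) *: X k,
            lie E (X k) = k%:R *: X k.-1 &
            lie Fm (X k) = (m - k)%:R *: X k.+1]),
      [/\ lie E Z = 0, lie H Z = 0, lie Fm Z = 0 &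
          forall k, (k < 2 * n)%N -> lie (X k) Z = 0] &
      (forall i j, (i < 2 * n)%N -> (j < 2 * n)%N ->
        lie (X i) (X j) = (if i + j == m then hcoef n i else 0) *: Z)].

Definition gfaithful (n d : nat) (E H Fm : 'M[F]_d) (X : nat -> 'M[F]_d)
    (Z : 'M[F]_d) : Prop :=
  forall (a b c w : F) (x : nat -> F),
    a *: E + b *: H + c *: Fm + \sum_(k < 2 * n) x k *: X k + w *: Z = 0 ->
    [/\ a = 0, b = 0, c = 0, w = 0 & forall k, (k < 2 * n)%N -> x k = 0].

Definition gacts (n d : nat) (E H Fm : 'M[F]_d) (X : nat -> 'M[F]_d)
    (Z : 'M[F]_d) : seq 'M[F]_d :=
  [:: E, H, Fm, Z & map X (iota 0 (2 * n))].

(* Subspaces of F^d are row spaces of matrices; since the action is on column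
   vectors, a subspace U is g-stable iff U *m A^T <= U for every generator A. *)
Definition submod d (acts : seq 'M[F]_d) (U : 'M[F]_d) : Prop :=
  forall A, A \in acts -> stablemx U A^T.

(* W/T is an irreducible submodule of V/T (T a submodule) *)
Definition minimal_over d (acts : seq 'M[F]_d) (T W : 'M[F]_d) : Prop :=
  [/\ submod acts W, (T < W)%MS &
      forall U : 'M[F]_d, submod acts U -> (T <= U)%MS -> (U <= W)%MS ->
        (U == T)%MS \/ (U == W)%MS].

(* S/T = soc(V/T): S is the sum (least upper bound) of T and all submodules
   W with W/T irreducible *)
Definition soc_step d (acts : seq 'M[F]_d) (T S : 'M[F]_d) : Prop :=
  [/\ (T <= S)%MS,
      (forall W, minimal_over acts T W -> (W <= S)%MS) &
      (forall U : 'M[F]_d, (T <= U)%MS ->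
         (forall W, minimal_over acts T W -> (W <= U)%MS) -> (S <= U)%MS)].

Definition socle_series d (acts : seq 'M[F]_d) (s : nat -> 'M[F]_d) : Prop :=
  (s 0%N == (0 : 'M[F]_d))%MS /\ forall i, soc_step acts (s i) (s i.+1).

Definition uniserial_len d (acts : seq 'M[F]_d) (l : nat) : Prop :=
  exists s : nat -> 'M[F]_d,
    [/\ socle_series acts s, (s l == 1%:M)%MS &
        forall i, (i < l)%N -> minimal_over acts (s i) (s i.+1)].

End Defs.

(* Main.v *)
(* Write L_1, ..., L_l for the socle factors. The ideal h_n kills every irreducible
   module: z is a commutator with central powers, hence singular, and the x_k are then
   commuting nilpotent operators. So L_i = V(a_i), the x_k induce equivariant maps
   L_(i+1) -> L_i, which are nonzero because sl(2)-modules are semisimple, and z maps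
   L_(i+2) to L_i. The submodules form a chain, so if z <> 0 then ker z = S_j for some
   1 < j < l, and z induces isomorphisms L_(j+i) -> L_i.

   If j = 2, then l > 3 gives isomorphisms L_3 -> L_1 and L_4 -> L_2 compatible with the
   x_k. Inverting them, the traces on L_3 and L_2 of the bracket relation
   [x_0, x_m] = m! z have left-hand sides that are opposite to each other, whence
   m! (dim L_3 + dim L_2) = 0.

   If j > 2, the induced maps L_(i+2) -> L_(i+1) -> L_i commute with one another up to
   i + 2 = j + 1. Evaluating P(x_0) Q(x_m) = P(x_m) Q(x_0) on weight vectors shows
   that such a commuting pair satisfies a_(i+1) = a_(i+2) + m or a_(i+1) = a_i + m, but
   not both since m is odd. Thus the steps of the sequence a_i are first +m, then one
   step of absolute value less than m, then -m (any of these parts may be absent);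
   all steps being odd, a_(j+1) <> a_1, contradicting L_(j+1) = L_1. *)

Require Import Defs.
From HB Require Import structures.
From mathcomp Require Import all_boot all_order all_algebra.
From mathcomp Require Import ring zify.
Set Implicit Arguments. Unset Strict Implicit. Unset Printing Implicit Defensive.
Import GRing.Theory.
Local Open Scope ring_scope.

Section LinearAlgebra.
Variable F : fieldType.

Lemma det0_of_trace_powers n (A : 'M[F]_n) :
  [pchar F] =i pred0 -> (0 < n)%N -> (forall k, \tr (A ^+ k.+1) = 0) -> \det A = 0.
Proof.
move=> /pcharf0P ch; case: n A => // n A _ trA.
have := congr1 mxtrace (Cayley_Hamilton A); rewrite mxtrace0.
rewrite -[X in horner_mx A X]coefK poly_def rmorph_sum /= raddf_sum /=.
rewrite size_char_poly big_ord_recl /= big1 => [|i _]; last first.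
  by rewrite linearZ /= rmorphXn /= horner_mx_X mxtraceZ trA mulr0.
rewrite addr0 linearZ /= expr0 rmorph1 mxtraceZ mxtrace1 char_poly_det.
by move/eqP; rewrite !mulf_eq0 signr_eq0 ch /= orbF => /eqP.
Qed.

Lemma det0_ker n (A : 'M[F]_n) : \det A = 0 -> kermx A != 0.
Proof.
move=> dA; rewrite -mxrank_eq0 mxrank_ker subn_eq0 -ltnNge.
rewrite ltn_neqAle rank_leq_row andbT; apply/negP => /eqP rA.
have : A \in unitmx by rewrite -row_free_unit -row_leq_rank rA.
by rewrite unitmxE dA unitr0.
Qed.

Lemma lie_weight_exp n (h A : 'M[F]_n) c :
  A *m h = h *m A + c *: A ->
  forall k, A ^+ k *m h = h *m A ^+ k + (k%:R * c) *: A ^+ k.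
Proof.
move=> hA; elim=> [|k IH]; first by rewrite expr0 mul0r scale0r addr0 mul1mx mulmx1.
rewrite exprS -mulmxA IH mulmxDr mulmxA hA mulmxDl -scalemxAr -scalemxAl -addrA -mulmxA.
by rewrite -scalerDl -[k.+1]addn1 natrD mulrDl mul1r [c + _]addrC.
Qed.

Lemma nilpotent_of_weight n (h A : 'M[F]_n) c :
  [pchar F] =i pred0 -> c != 0 -> A *m h = h *m A + c *: A -> exists k, A ^+ k = 0.
Proof.
move=> /pcharf0P ch c0 hA.
pose ad := lin_mx (mulmxr h) - lin_mx (mulmx h) : 'M[F]_(n * n).
have [/existsP[k /eqP]|/existsPn nz] :=
  boolP [exists k : 'I_(n * n).+1, A ^+ k == 0]; first by exists k.
have eig (k : 'I_(n * n).+1) : root (char_poly ad) (k%:R * c).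
  rewrite -eigenvalue_root_char; apply/eigenvalueP; exists (mxvec (A ^+ k)).
    rewrite mulmxBr !mul_vec_lin /= -linearB /= (lie_weight_exp hA) addrC addKr.
    by rewrite linearZ.
  by rewrite mxvec_eq0 nz.
pose rs := [seq (k%:R * c) | k : 'I_(n * n).+1].
suff : (size rs < size (char_poly ad))%N.
  by rewrite size_char_poly size_map size_enum_ord ltnn.
apply: max_poly_roots.
- by rewrite -size_poly_eq0 size_char_poly.
- by apply/allP=> _ /mapP[k _ ->]; apply: eig.
rewrite map_inj_uniq ?enum_uniq // => i j /(mulIf c0) /eqP.
wlog ij : i j / (i <= j)%N => [H|].
  by case: (leqP i j) => [/H//|/ltnW /H E]; rewrite eq_sym => /E.
rewrite eq_sym -subr_eq0 -natrB // ch subn_eq0 => ji.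
by apply/val_inj/eqP; rewrite eqn_leq ij.
Qed.

Lemma nilpotent_step n (A : 'M[F]_n) k (v : 'rV[F]_n) :
  A ^+ k = 0 -> v != 0 -> exists2 j, v *m A ^+ j != 0 & v *m A ^+ j *m A = 0.
Proof.
move=> Ak v0.
have ex : exists j, v *m A ^+ j == 0 by exists k; rewrite Ak mulmx0.
case: (ex_minnP ex) => [[|j]]; first by rewrite expr0 mulmx1 (negPf v0).
move=> /eqP vj minj; exists j; last by rewrite -mulmxA -[A ^+ j *m A]exprSr.
by apply/negP => /minj; rewrite ltnn.
Qed.

Lemma sub_of_rows m n p (U : 'M[F]_(m, n)) (A : 'M[F]_(n, p)) q (W : 'M[F]_(q, p)) :
  (forall v : 'rV_n, (v <= U)%MS -> (v *m A <= W)%MS) -> (U *m A <= W)%MS.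
Proof.
by move=> H; apply/row_subP => i; rewrite row_mul; apply: H; apply: row_sub.
Qed.

(* B is a basis of a complement of T in W, and C reads off the coordinates of
   a vector of W modulo T. *)
Definition subquotient d r (T W : 'M[F]_d) (B : 'M_(r, d)) (C : 'M_(d, r)) :=
  [/\ (T <= W)%MS, (B <= W)%MS, B *m C = 1%:M, T *m C = 0 &
      forall k (v : 'M_(k, d)), (v <= W)%MS -> (v - v *m C *m B <= T)%MS].

Lemma subquotient_exists d (T W : 'M[F]_d) : (T <= W)%MS ->
  exists r (B : 'M_(r, d)) C,
    (r + \rank T = \rank W)%N /\ subquotient T W B C.
Proof.
move=> TW; pose D := (W :\: T)%MS.
have DT0 : (D :&: T = 0)%MS by rewrite capmx_diff.
have DW : (D <= W)%MS by apply: diffmxSl.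
have sW : (W <= D + T)%MS.
  rewrite -{1}(addsmx_diff_cap_eq W T) addsmxS //.
  exact: capmxSr.
have rk : (\rank D + \rank T = \rank W)%N.
  rewrite -(mxrank_disjoint_sum DT0); apply/eqP; rewrite eqn_leq !mxrankS //.
  by rewrite addsmx_sub DW.
exists (\rank D), (row_base D), (proj_mx D T *m pinvmx (row_base D)); split=> //.
have prD k (v : 'M_(k, d)) : (v *m proj_mx D T <= row_base D)%MS.
  by rewrite eq_row_base proj_mx_sub.
split=> //.
- by rewrite eq_row_base.
- rewrite mulmxA proj_mx_id ?eq_row_base //.
  by rewrite mulmxVp ?row_base_free.
- by rewrite mulmxA proj_mx_0 ?mul0mx.
move=> k v vW; rewrite mulmxA mulmxKpV //.
rewrite -{1}(add_proj_mx DT0 (submx_trans vW sW)) addrC addKr.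
exact: proj_mx_sub.
Qed.

Lemma subquotient_mul d r s (T W : 'M[F]_d) (B : 'M_(r, d)) C
    (C' : 'M[F]_(d, s)) (A : 'M_d) k (v : 'M_(k, d)) :
  subquotient T W B C -> (v <= W)%MS -> T *m A *m C' = 0 ->
  v *m C *m (B *m A *m C') = v *m A *m C'.
Proof.
case=> _ _ _ _ H vW TA; have /submxP[D hD] := H _ _ vW.
apply/esym/eqP; rewrite !mulmxA -subr_eq0 -!mulmxBl hD.
by rewrite -!mulmxA (mulmxA T) TA mulmx0.
Qed.

Lemma subquotient_stable_mul d r (T W : 'M[F]_d) (B : 'M_(r, d)) C (A A' : 'M_d) :
  subquotient T W B C -> stablemx W A -> stablemx T A' ->
  (B *m A *m C) *m (B *m A' *m C) = B *m (A *m A') *m C.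
Proof.
move=> sq sW sT; have [TW BW _ TC _] := sq.
rewrite (subquotient_mul sq) ?mulmxA //.
  by apply: submx_trans sW; apply: submxMr.
by have /submxP[D ->] := sT; rewrite -mulmxA TC mulmx0.
Qed.

Lemma subquotient_eq0 d r s (T W T' W' A : 'M[F]_d) (B : 'M_(r, d)) C
    (B' : 'M_(s, d)) C' :
  subquotient T W B C -> subquotient T' W' B' C' -> (W *m A <= W')%MS ->
  (T *m A <= T')%MS -> B *m A *m C' = 0 -> (W *m A <= T')%MS.
Proof.
move=> [TW BW BC TC H] [TW' BW' BC' TC' H'] WA TA z.
have WB : (W <= T + B)%MS.
  rewrite -[W](subrK (W *m C *m B)) addmx_sub_adds ?H // submxMl //.
have : (W *m A <= (T + B)%MS *m A)%MS by apply: submxMr.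
move/submx_trans; apply; rewrite addsmxMr addsmx_sub TA /=.
have BAW : (B *m A <= W')%MS by apply: submx_trans WA; apply: submxMr.
by have := H' _ _ BAW; rewrite z mul0mx subr0.
Qed.

Definition acts_stable d (acts : seq 'M[F]_d) (U : 'M[F]_d) : bool :=
  all (fun A => stablemx U A) acts.

Definition irreducible_acts d (acts : seq 'M[F]_d) : Prop :=
  (0 < d)%N /\ forall U : 'M[F]_d, acts_stable acts U -> U = 0 \/ row_full U.

Lemma acts_stable_lift d r (T W : 'M[F]_d) (B : 'M_(r, d)) C acts (U : 'M_r) :
  subquotient T W B C -> acts_stable acts T -> acts_stable acts W ->
  acts_stable [seq B *m A *m C | A <- acts] U ->
  acts_stable acts (T + U *m B)%MS.
Proof.
case=> TW BW BC TC H /allP iT /allP iW /allP iU; apply/allP => A Aa.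
rewrite addsmxMr addsmx_sub (submx_trans (iT _ Aa)) ?addsmxSl //=.
have UW : (U *m B *m A <= W)%MS.
  apply: submx_trans (iW _ Aa); apply: submxMr.
  exact: submx_trans (submxMl _ _) BW.
rewrite -[U *m B *m A](subrK (U *m B *m A *m C *m B)) addmx_sub_adds ?H //.
apply: submxMr; have := iU _ (map_f (fun A => B *m A *m C) Aa).
by rewrite !mulmxA.
Qed.

Lemma subquotient_irreducible d r (T W : 'M[F]_d) (B : 'M_(r, d)) C acts :
  subquotient T W B C -> acts_stable acts T -> acts_stable acts W ->
  (forall U, acts_stable acts U -> (T <= U)%MS -> (U <= W)%MS ->
     (U <= T)%MS \/ (W <= U)%MS) -> ~~ (W <= T)%MS ->
  irreducible_acts [seq B *m A *m C | A <- acts].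
Proof.
move=> sq iT iW minW nWT; have [TW BW BC TC H] := sq.
split.
  case: (posnP r) => // r0; case/negP: nWT; subst r.
  by have := H _ W (submx_refl _); rewrite [B]flatmx0 mulmx0 subr0.
move=> U iU; have iL := acts_stable_lift sq iT iW iU.
case: (minW _ iL); rewrite ?addsmxSl //.
- by rewrite addsmx_sub TW (submx_trans (submxMl _ _) BW).
- rewrite addsmx_sub submx_refl /= => /submxP[D hD]; left.
  by rewrite -[U]mulmx1 -BC mulmxA hD -mulmxA TC mulmx0.
move=> WU; right; rewrite -sub1mx -BC.
apply: (@submx_trans _ _ _ _ _ _ ((T + U *m B)%MS *m C)).
  by apply: submxMr; apply: submx_trans WU.
by rewrite addsmxMr addsmx_sub TC sub0mx /= -mulmxA BC mulmx1.
Qed.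

End LinearAlgebra.

Section SL2.
Variable F : fieldType.
Hypothesis charF0 : [pchar F] =i pred0.

Lemma natF_eq0 n : (n%:R == 0 :> F) = (n == 0)%N.
Proof. by move/pcharf0P: charF0. Qed.

Lemma natF_inj a b : a%:R = b%:R :> F -> a = b.
Proof.
wlog ab : a b / (a <= b)%N => [H|] E.
  by case: (leqP a b) => [/H->//|/ltnW /H->].
apply/eqP; rewrite eqn_leq ab /= -subn_eq0 -natF_eq0 natrB //.
by rewrite E subrr.
Qed.

Definition sl2_rep n (e h f : 'M[F]_n) : Prop :=
  [/\ e *m h = h *m e + 2%:R *: e,
      f *m h = h *m f - 2%:R *: f & f *m e = e *m f + h].

Definition fpow n (f : 'M[F]_n) i (w : 'rV[F]_n) := w *m f ^+ i.

Lemma fpow0 n (f : 'M[F]_n) w : fpow f 0 w = w.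
Proof. by rewrite /fpow expr0 mulmx1. Qed.

Lemma fpowS n (f : 'M[F]_n) i w : fpow f i.+1 w = fpow f i w *m f.
Proof. by rewrite /fpow exprSr mulmxA. Qed.

Section HighestWeight.
Variables (n : nat) (e h f : 'M[F]_n) (w : 'rV[F]_n) (al : F).
Hypotheses (rep : sl2_rep e h f) (we : w *m e = 0) (wh : w *m h = al *: w).

Lemma fpow_h i : fpow f i w *m h = (al - (2 * i)%:R) *: fpow f i w.
Proof.
case: rep => _ fh _; elim: i => [|i IH]; first by rewrite fpow0 muln0 subr0.
rewrite fpowS -mulmxA fh mulmxBr mulmxA IH -scalemxAr -!scalemxAl -scalerBl.
by congr (_ *: _); ring.
Qed.

Lemma fpow_e i :
  fpow f i.+1 w *m e = (i.+1%:R * (al - i%:R)) *: fpow f i w.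
Proof.
case: rep => _ _ fe; elim: i => [|i IH].
  rewrite fpowS fpow0 -mulmxA fe mulmxDr mulmxA we mul0mx add0r wh subr0.
  by rewrite mul1r.
rewrite fpowS -mulmxA fe mulmxDr mulmxA IH -scalemxAl -fpowS fpow_h -scalerDl.
by congr (_ *: _); ring.
Qed.

Lemma fpow_last N : (forall i, (i <= N)%N -> fpow f i w != 0) ->
  fpow f N.+1 w = 0 -> al = N%:R.
Proof.
move=> nz z; have := fpow_e N; rewrite z mul0mx => /esym/eqP.
rewrite scaler_eq0 (negPf (nz _ _)) // orbF mulf_eq0 natF_eq0 /= subr_eq0.
by move/eqP.
Qed.

End HighestWeight.

Record hw_rep n (e h f : 'M[F]_n) (a : nat) (w : 'rV[F]_n) : Prop := HwRep {
  hw_sl2 : sl2_rep e h f;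
  hw_neq0 : w != 0;
  hw_e : w *m e = 0;
  hw_h : w *m h = a%:R *: w;
  hw_top : fpow f a.+1 w = 0;
  hw_span : forall v : 'rV_n, exists c : nat -> F, v = \sum_(i < a.+1) c i *: fpow f i w }.

Lemma f_weight n (e h f : 'M[F]_n) : sl2_rep e h f -> f *m h = h *m f + (- 2%:R) *: f.
Proof. by case=> _ -> _; rewrite scaleNr. Qed.

Lemma fpow_mulh n (e h f : 'M[F]_n) r x : sl2_rep e h f ->
  fpow f r x *m h = fpow f r (x *m h) - (2 * r)%:R *: fpow f r x.
Proof.
move=> rep; elim: r => [|r IHr]; first by rewrite !fpow0 muln0 scale0r subr0.
rewrite !fpowS -mulmxA (f_weight rep) mulmxDr mulmxA IHr mulmxBl -!scalemxAl.
by rewrite -scalemxAr scaleNr -addrA -opprD -scalerDl -natrD addnC -mulnS.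
Qed.

Lemma fpow_mule n (e h f : 'M[F]_n) i x : sl2_rep e h f -> x *m e = 0 ->
  fpow f i.+1 x *m e = i.+1%:R *: fpow f i (x *m h - i%:R *: x).
Proof.
move=> rep xe; have [_ _ fe] := rep; elim: i => [|i IH].
  rewrite fpowS !fpow0 -mulmxA fe mulmxDr mulmxA xe mul0mx add0r.
  by rewrite !scale1r scale0r subr0.
rewrite fpowS -mulmxA fe mulmxDr mulmxA IH -scalemxAl -fpowS (fpow_mulh _ _ rep).
rewrite /fpow !mulmxBl !scalerBr -!scalemxAl !scalerA.
rewrite addrACA -opprD -!scalerDl -[X in _ + X - _]scale1r -scalerDl.
by congr (_ *: _ - _ *: _); ring.
Qed.

Lemma fpow_nilpotent n (e h f : 'M[F]_n) : sl2_rep e h f -> exists k, f ^+ k = 0.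
Proof.
move=> rep; apply: (nilpotent_of_weight charF0 _ (f_weight rep)).
by rewrite oppr_eq0 natF_eq0.
Qed.

Lemma hw_vector n (e h f : 'M[F]_n) (u : 'rV[F]_n) : sl2_rep e h f -> u != 0 ->
  exists a (w : 'rV_n), [/\ w != 0, w *m e = 0 & w *m h = a%:R *: w].
Proof.
move=> rep u0; have [eh _ fe] := rep.
have n2 : (2%:R : F) != 0 by rewrite natF_eq0.
have [k ek] := nilpotent_of_weight charF0 n2 eh.
have [j v0 ve] := nilpotent_step ek u0.
have [N fN] := fpow_nilpotent rep.
have : fpow f N (u *m e ^+ j) = 0 by rewrite /fpow fN mulmx0.
(* On the kernel of e, e^N f^N acts as N! h (h - 1) ... (h - N + 1); peeling off the
   factors one at a time produces an eigenvector of h. *)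
elim: N (u *m e ^+ j) v0 ve {fN} => [|N IH] x x0 xe.
  by rewrite fpow0 => /eqP; rewrite (negPf x0).
move=> xN; have [/eqP|x'0] := eqVneq (x *m h - N%:R *: x) 0.
  by rewrite subr_eq0 => /eqP xh; exists N, x.
apply: IH x'0 _ _.
  rewrite mulmxBl -scalemxAl xe scaler0 subr0 -mulmxA.
  have -> : h *m e = e *m h - 2%:R *: e by rewrite eh addrK.
  by rewrite mulmxBr -scalemxAr mulmxA xe mul0mx scaler0 subr0.
have := fpow_mule N rep xe; rewrite xN mul0mx => /esym/eqP.
by rewrite scaler_eq0 natF_eq0 => /eqP.
Qed.

Lemma hw_vector_top n (e h f : 'M[F]_n) a (w : 'rV[F]_n) : sl2_rep e h f ->
  w != 0 -> w *m e = 0 -> w *m h = a%:R *: w -> fpow f a.+1 w = 0.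
Proof.
move=> rep w0 we wh; have [M fM] := fpow_nilpotent rep.
have ex : exists i, fpow f i w == 0 by exists M; rewrite /fpow fM mulmx0.
case: (ex_minnP ex) => [[|N]]; first by rewrite fpow0 (negPf w0).
move=> /eqP wN minN.
have nz i : (i <= N)%N -> fpow f i w != 0.
  by move=> iN; apply/negP => /minN; rewrite ltnNge iN.
by have -> : a = N by apply: natF_inj; apply: (fpow_last rep we wh nz wN).
Qed.

Lemma hw_rep_of_vector n (e h f : 'M[F]_n) a (w : 'rV[F]_n) : sl2_rep e h f ->
  w != 0 -> w *m e = 0 -> w *m h = a%:R *: w ->
  (forall U : 'M_n, acts_stable [:: e; h; f] U -> (w <= U)%MS -> row_full U) ->
  hw_rep e h f a w.
Proof.
move=> rep w0 we wh gen; have wa := hw_vector_top rep w0 we wh.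
split=> // v; pose U := (\sum_(i < a.+1) <<fpow f i w>>)%MS.
have Ui (i : nat) c : (c *: fpow f i w <= U)%MS.
  case: (ltnP i a.+1) => [ia|ia].
    apply: (sumsmx_sup (Ordinal ia)) => //; rewrite genmxE; exact: scalemx_sub.
  rewrite -(subnKC ia) /fpow exprD mulmxA -/(fpow f a.+1 w) wa mul0mx scaler0.
  exact: sub0mx.
have sU : acts_stable [:: e; h; f] U.
  rewrite /acts_stable /=; apply/and4P; split=> //; rewrite /U sumsmxMr_gen;
    apply/sumsmx_subP => i _; rewrite genmxE (eqmxMr _ (genmxE _)).
  - case: i => [[|i] ia] /=; first by rewrite fpow0 we sub0mx.
    by rewrite (fpow_e rep we wh) Ui.
  - by rewrite (fpow_h rep wh) Ui.
  - by rewrite -fpowS -[fpow _ _ _]scale1r Ui.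
have fU : row_full U by apply: gen sU _; rewrite -[w]scale1r -[w](fpow0 f) Ui.
have /sub_sumsmxP[u ->] := submx_full v fU.
have /fin_all_exists[c hc] (i : 'I_a.+1) :
    exists c, u i *m <<fpow f i w>>%MS = c *: fpow f i w.
  apply/sub_rVP; apply: submx_trans (submxMl _ _) _; by rewrite genmxE.
exists (fun i => if insub i is Some j then c j else 0).
by apply: eq_bigr => i _; rewrite hc valK.
Qed.

Lemma hw_rep_exists n (e h f : 'M[F]_n) : sl2_rep e h f ->
  irreducible_acts [:: e; h; f] -> exists a w, hw_rep e h f a w.
Proof.
move=> rep [n0 irr].
have u0 : const_mx 1 != 0 :> 'rV[F]_n.
  apply/eqP => /rowP/(_ (Ordinal n0)); rewrite !mxE => /eqP.
  by rewrite oner_eq0.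
have [a [w [w0 we wh]]] := hw_vector rep u0.
exists a, w; apply: hw_rep_of_vector => // U sU wU.
by case: (irr U sU) => // U0; case/negP: w0; rewrite -submx0 -U0.
Qed.

Section HwFacts.
Variables (n : nat) (e h f : 'M[F]_n) (a : nat) (w : 'rV[F]_n).
Hypothesis hw : hw_rep e h f a w.
Local Notation w_ i := (fpow f i w).

Lemma hw_fh i : w_ i *m h = (a%:R - (2 * i)%:R) *: w_ i.
Proof. exact: fpow_h (hw_sl2 hw) (hw_h hw) i. Qed.

Lemma hw_fe i : w_ i.+1 *m e = (i.+1%:R * (a%:R - i%:R)) *: w_ i.
Proof. exact: fpow_e (hw_sl2 hw) (hw_e hw) (hw_h hw) i. Qed.

Lemma hw_fe_coef_neq0 i : (i < a)%N -> i.+1%:R * (a%:R - i%:R) != 0 :> F.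
Proof. by move=> ia; rewrite -natrB ?(ltnW ia) // mulf_neq0 // natF_eq0 // subn_eq0 -ltnNge. Qed.

Lemma hw_fpow_big i : (a < i)%N -> w_ i = 0.
Proof.
by move=> ai; rewrite -(subnKC ai) /fpow exprD mulmxA -/(fpow f a.+1 w) (hw_top hw) mul0mx.
Qed.

Lemma hw_free k (c : nat -> F) : (k <= a.+1)%N -> \sum_(i < k) c i *: w_ i = 0 ->
  forall i, (i < k)%N -> c i = 0.
Proof.
elim: k c => // k IH c ka sum0.
have c' i : (i < k)%N -> c i.+1 = 0.
  move=> ik; have := congr1 (mulmx^~ e) sum0; rewrite /= mul0mx mulmx_suml.
  rewrite big_ord_recl -scalemxAl fpow0 (hw_e hw) scaler0 add0r.
  under eq_bigr => j _ do rewrite -scalemxAl hw_fe scalerA.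
  move/(IH (fun i => c i.+1 * (i.+1%:R * (a%:R - i%:R))) (ltnW ka))/(_ i ik)/eqP.
  rewrite mulf_eq0 (negPf (hw_fe_coef_neq0 _)) ?orbF; first by move/eqP.
  by apply: leq_trans ik _; rewrite -ltnS.
move=> [_|i]; last exact: c'.
move/eqP: sum0; rewrite big_ord_recl big1 => [|i _]; last by rewrite c' ?scale0r.
by rewrite addr0 fpow0 scaler_eq0 (negPf (hw_neq0 hw)) orbF => /eqP.
Qed.

Lemma hw_dim : n = a.+1.
Proof.
pose W := \matrix_(i < a.+1) w_ i.
have fr : row_free W.
  apply: inj_row_free => v; rewrite mulmx_sum_row => v0; apply/rowP => j.
  have := @hw_free a.+1 (fun i => v 0 (inord i)) (leqnn _) _ j (ltn_ord j).
  rewrite inord_val mxE; apply; rewrite -[RHS]v0.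
  by apply: eq_bigr => i _; rewrite inord_val rowK.
have fu : row_full W.
  rewrite -sub1mx; apply/row_subP => j; have [c ->] := hw_span hw (row j 1%:M).
  by apply: summx_sub => i _; rewrite scalemx_sub // -(rowK (fun i => w_ i) i) row_sub.
by rewrite -(eqP fu) (eqP fr).
Qed.

Lemma hw_coef (c : nat -> F) j : (j <= a)%N -> \sum_(i < a.+1) c i *: w_ i = 0 -> c j = 0.
Proof. by move=> ja /hw_free; apply. Qed.

Lemma hw_only (v : 'rV[F]_n) (c : nat -> F) r : v = \sum_(i < a.+1) c i *: w_ i ->
  (forall i, (i <= a)%N -> i != r -> c i = 0) -> exists k, v = k *: w_ r.
Proof.
move=> -> c0; have [ra|ra] := leqP r a; last first.
  exists 0; rewrite scale0r big1 // => i _; rewrite c0 ?scale0r //; first by rewrite -ltnS.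
  by apply: contraTneq ra => <-; rewrite -leqNgt -ltnS.
exists (c r); rewrite (bigD1 (Ordinal (ra : (r < a.+1)%N))) //= big1 ?addr0 // => i ir.
by rewrite c0 ?scale0r // -ltnS.
Qed.

Lemma hw_ker_e v : v *m e = 0 -> exists k, v = k *: w.
Proof.
have [c hc] := hw_span hw v => ve.
rewrite -[w](fpow0 f); apply: (hw_only hc) => -[//|i] ia _.
move: ve; rewrite hc mulmx_suml big_ord_recl -scalemxAl fpow0 (hw_e hw) scaler0 add0r.
under eq_bigr => j _ do rewrite -scalemxAl hw_fe scalerA.
move/(@hw_free a (fun i => c i.+1 * (i.+1%:R * (a%:R - i%:R))) (leqnSn _))/(_ i ia)/eqP.
by rewrite mulf_eq0 (negPf (hw_fe_coef_neq0 _)) // orbF => /eqP.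
Qed.

Lemma hw_ker_f v : v *m f = 0 -> exists k, v = k *: w_ a.
Proof.
have [c hc] := hw_span hw v => vf.
apply: (hw_only hc) => i ia ia'; have {ia ia'}ia : (i < a)%N by rewrite ltn_neqAle ia' ia.
move: vf; rewrite hc mulmx_suml.
under eq_bigr => j _ do rewrite -scalemxAl -fpowS.
rewrite big_ord_recr /= (hw_top hw) scaler0 addr0 => sum0.
have := @hw_free a.+1 (fun i => if i is i'.+1 then c i' else 0) (leqnn _).
rewrite big_ord_recl scale0r add0r => /(_ sum0 i.+1); exact.
Qed.

Lemma hw_weight v mu : v *m h = mu *: v -> forall r,
  (forall i, (i <= a)%N -> i != r -> mu != a%:R - (2 * i)%:R) -> exists k, v = k *: w_ r.
Proof.
have [c hc] := hw_span hw v => vh r mur; apply: (hw_only hc) => i ia ir.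
move/eqP: vh; rewrite hc mulmx_suml scaler_sumr -subr_eq0 -sumrB => /eqP.
under eq_bigr => j _ do rewrite -scalemxAl hw_fh !scalerA -scalerBl.
move/(@hw_coef (fun i => c i * (a%:R - (2 * i)%:R) - mu * c i) _ ia)/eqP.
rewrite mulrC -mulrBl mulf_eq0 subr_eq0 eq_sym (negPf (mur _ ia ir)) /=.
by move/eqP.
Qed.

Lemma hw_weight_out (v : 'rV[F]_n) mu : v *m h = mu *: v ->
  (forall i, (i <= a)%N -> mu != a%:R - (2 * i)%:R) -> v = 0.
Proof.
move=> vh H; have [k ->] := hw_weight vh (r := a.+1) (fun i ia _ => H i ia).
by rewrite (hw_top hw) scaler0.
Qed.

Lemma hw_lowest_notin_im_e v k : v *m e = k *: w_ a -> k = 0.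
Proof.
have [c hc] := hw_span hw v; rewrite hc mulmx_suml big_ord_recl -scalemxAl.
rewrite fpow0 (hw_e hw) scaler0 add0r => /eqP; rewrite -subr_eq0 => /eqP.
under eq_bigr => j _ do rewrite -scalemxAl hw_fe scalerA.
move=> sum0; apply/eqP; rewrite -oppr_eq0; apply/eqP.
have := @hw_free a.+1
  (fun i => if (i < a)%N then c i.+1 * (i.+1%:R * (a%:R - i%:R)) else - k) (leqnn _).
rewrite big_ord_recr /= ltnn scaleNr.
under eq_bigr => j _ do rewrite ltn_ord.
by move=> /(_ sum0 a (ltnSn a)); rewrite ltnn.
Qed.

Lemma hw_mod_im_e v : exists k u, v = k *: w_ a + u *m e.
Proof.
have [c ->] := hw_span hw v.
exists (c a), (\sum_(i < a) (c i / (i.+1%:R * (a%:R - i%:R))) *: w_ i.+1).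
rewrite big_ord_recr /= addrC; congr (_ + _); rewrite mulmx_suml.
apply: eq_bigr => i _; rewrite -scalemxAl hw_fe scalerA divfK //.
exact: hw_fe_coef_neq0.
Qed.

End HwFacts.
End SL2.

Section Tensor.
Variable F : fieldType.
Hypothesis charF0 : [pchar F] =i pred0.
Variable m : nat.

(* P k is the action of x_k in an equivariant map V(m) (x) B -> A. *)
Definition tensor_op nB nA (eB hB fB : 'M[F]_nB) (eA hA fA : 'M[F]_nA)
    (P : nat -> 'M[F]_(nB, nA)) : Prop :=
  forall k, (k <= m)%N ->
    [/\ P k *m hA = hB *m P k + (m%:R - (2 * k)%:R) *: P k,
        P k *m eA = eB *m P k + k%:R *: P k.-1 &
        P k *m fA = fB *m P k + (m - k)%:R *: P k.+1].

Section One.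
Variables (nB nA : nat) (eB hB fB : 'M[F]_nB) (eA hA fA : 'M[F]_nA).
Variables (P : nat -> 'M[F]_(nB, nA)) (b a : nat) (wB : 'rV[F]_nB) (wA : 'rV[F]_nA).
Hypotheses (hwB : hw_rep eB hB fB b wB) (hwA : hw_rep eA hA fA a wA).
Hypothesis PT : tensor_op eB hB fB eA hA fA P.
Local Notation w_ i := (fpow fB i wB).

Lemma tensor_mulh i k : (k <= m)%N ->
  w_ i *m P k *m hA = (b%:R - (2 * i)%:R + (m%:R - (2 * k)%:R)) *: (w_ i *m P k).
Proof.
move=> /PT[Ph _ _].
by rewrite -mulmxA Ph mulmxDr mulmxA (hw_fh hwB) -scalemxAr -scalemxAl -scalerDl.
Qed.

Lemma weight_natE i k j :
  b%:R - (2 * i)%:R + (m%:R - (2 * k)%:R) = a%:R - (2 * j)%:R :> F ->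
  (b + m + 2 * j = a + 2 * (i + k))%N.
Proof.
move/eqP; rewrite -subr_eq0 => /eqP E; apply: (natF_inj charF0).
apply/eqP; rewrite -subr_eq0 -{}E; apply/eqP.
by rewrite !mulnDr !natrD; ring.
Qed.

Lemma tensor_weight_out i k : (k <= m)%N ->
  (forall j, (j <= a)%N -> b + m + 2 * j != a + 2 * (i + k))%N -> w_ i *m P k = 0.
Proof.
move=> km H; apply: (hw_weight_out charF0 hwA (tensor_mulh i km)) => j ja.
by apply: contra (H j ja) => /eqP/weight_natE ->.
Qed.

Lemma tensor_weight i k r : (k <= m)%N -> (b + m + 2 * r = a + 2 * (i + k))%N ->
  exists c, w_ i *m P k = c *: fpow fA r wA.
Proof.
move=> km E; apply: (hw_weight charF0 hwA (tensor_mulh i km)) => j ja.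
by apply: contra => /eqP/weight_natE E'; apply/eqP; lia.
Qed.

Lemma tensor_hw_weight i k : (k <= m)%N -> w_ i *m P k *m eA = 0 ->
  w_ i *m P k != 0 -> (b + m = a + 2 * (i + k))%N.
Proof.
move=> km /(hw_ker_e charF0 hwA)[c wc] nz.
have := tensor_mulh i km; rewrite wc -scalemxAl (hw_h hwA) scalerA mulrC -scalerA.
move/eqP; rewrite -subr_eq0 -scalerBl -wc scaler_eq0 (negPf nz) orbF subr_eq0 => /eqP E.
by have := @weight_natE i k 0; rewrite -E !muln0 subr0 addn0 => /(_ erefl).
Qed.

Lemma tensor0 : P 0%N = 0 -> forall k, (k <= m)%N -> P k = 0.
Proof.
move=> P0; elim=> // k IH km; have [_ _] := PT (ltnW km).
rewrite (IH (ltnW km)) mul0mx mulmx0 add0r => /esym/eqP.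
by rewrite scaler_eq0 natF_eq0 // subn_eq0 leqNgt km => /eqP.
Qed.

Hypothesis Pn0 : exists2 k, (k <= m)%N & P k != 0.

Lemma tensor_P0_neq0 : P 0%N != 0.
Proof. by case: Pn0 => k km; apply: contra_neq => /tensor0->. Qed.

Lemma tensor_hw_Pm : wB *m P m != 0.
Proof.
apply/negP => /eqP wPm.
have wP k : (k <= m)%N -> wB *m P k = 0.
  move=> km; rewrite -(subKn km); elim: (m - k)%N (leq_subr k m) => [|i IH] im.
    by rewrite subn0.
  have km' : (m - i <= m)%N by apply: leq_subr.
  have [_ Pe _] := PT km'.
  have := congr1 (mulmx wB) Pe; rewrite mulmxA IH ?(ltnW im) // mul0mx mulmxDr mulmxA.
  rewrite (hw_e hwB) mul0mx add0r -scalemxAr => /esym/eqP.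
  by rewrite scaler_eq0 natF_eq0 // subn_eq0 leqNgt im /= -subnS => /eqP.
have wfP i : forall k, (k <= m)%N -> w_ i *m P k = 0.
  elim: i => [|i IH] k km; first by rewrite fpow0 wP.
  have [_ _ Pf] := PT km.
  rewrite fpowS -mulmxA; have -> : fB *m P k = P k *m fA - (m - k)%:R *: P k.+1.
    by rewrite Pf addrK.
  rewrite mulmxBr mulmxA IH // mul0mx -scalemxAr sub0r.
  by move: km; rewrite leq_eqVlt => /predU1P[->|/IH->]; rewrite ?subnn ?scale0r ?scaler0 oppr0.
case: Pn0 => k km /eqP[]; apply/row_matrixP => i; rewrite row0 rowE.
have [c ->] := hw_span hwB (delta_mx 0 i).
by rewrite mulmx_suml big1 // => j _; rewrite -scalemxAl wfP // scaler0.
Qed.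

Lemma tensor_triangle : exists p, [/\ (p <= m)%N, (a + 2 * p = b + m)%N,
  wB *m P p != 0 & forall k, (k < p)%N -> wB *m P k = 0].
Proof.
have ex : exists k, wB *m P k != 0 by exists m; apply: tensor_hw_Pm.
case: (ex_minnP ex) => p wp minp; have pm : (p <= m)%N by apply: minp; apply: tensor_hw_Pm.
have below k : (k < p)%N -> wB *m P k = 0.
  by move=> kp; apply/eqP; apply: contraLR kp => /minp; rewrite -leqNgt.
exists p; split=> //.
have wpe : wB *m P p *m eA = 0.
  have [_ Pe _] := PT pm; rewrite -mulmxA Pe mulmxDr mulmxA (hw_e hwB) mul0mx add0r.
  rewrite -scalemxAr; case: p {wp minp pm Pe} below => [|p] below; first by rewrite scale0r.
  by rewrite below ?scaler0.
have := @tensor_hw_weight 0 p pm; rewrite fpow0 => /(_ wpe wp) ->.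
by rewrite add0n.
Qed.

Lemma tensor_fpow_neq0 r : (r <= b)%N -> (r == b) || (b + m <= a + 2 * r)%N ->
  w_ r *m P 0%N != 0.
Proof.
move=> rb rhi; apply: contra tensor_P0_neq0 => /eqP wr.
have PTe : P 0%N *m eA = eB *m P 0%N.
  by have [_ -> _] := PT (leq0n m); rewrite scale0r addr0.
have st i : w_ i.+1 *m P 0%N *m eA = (i.+1%:R * (b%:R - i%:R)) *: (w_ i *m P 0%N).
  by rewrite -mulmxA PTe mulmxA (hw_fe hwB) -scalemxAl.
have down i : (i <= r)%N -> w_ (r - i) *m P 0%N = 0.
  elim: i => [|i IH] ir; first by rewrite subn0.
  have := st (r - i.+1)%N; have -> : w_ (r - i.+1).+1 = w_ (r - i) by rewrite subnSK.
  rewrite IH ?(ltnW ir) // mul0mx.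
  move=> /esym/eqP; rewrite scaler_eq0 (negPf (hw_fe_coef_neq0 charF0 _)) /=; first by move/eqP.
  by apply: leq_trans rb; rewrite ltn_subrL /= (leq_ltn_trans _ ir).
have up i : w_ (r + i) *m P 0%N = 0.
  case/orP: rhi => [/eqP E|rhi].
    case: i => [|i]; first by rewrite addn0.
    by rewrite (hw_fpow_big hwB) ?mul0mx // E -addn1 leq_add2l.
  elim: i => [|i IH]; first by rewrite addn0.
  have := st (r + i)%N; rewrite IH scaler0 -addnS => /(tensor_hw_weight (leq0n m)) E.
  by apply/eqP/negPn/negP => /E; lia.
apply/eqP/row_matrixP => i; rewrite row0 rowE.
have [c ->] := hw_span hwB (delta_mx 0 i).
rewrite mulmx_suml big1 // => j _; rewrite -scalemxAl.
case: (leqP r j) => jr; first by rewrite -(subnKC jr) up scaler0.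
by rewrite -(subKn (ltnW jr)) down ?leq_subr // scaler0.
Qed.

End One.

Section Two.
Variables (nC nB nA : nat) (eC hC fC : 'M[F]_nC) (eB hB fB : 'M[F]_nB) (eA hA fA : 'M[F]_nA).
Variables (Q : nat -> 'M[F]_(nC, nB)) (P : nat -> 'M[F]_(nB, nA)).
Variables (c b a : nat) (wC : 'rV[F]_nC) (wB : 'rV[F]_nB) (wA : 'rV[F]_nA).
Hypotheses (hwC : hw_rep eC hC fC c wC) (hwB : hw_rep eB hB fB b wB).
Hypotheses (hwA : hw_rep eA hA fA a wA).
Hypotheses (QT : tensor_op eC hC fC eB hB fB Q) (PT : tensor_op eB hB fB eA hA fA P).
Hypotheses (Qn0 : exists2 k, (k <= m)%N & Q k != 0).
Hypotheses (Pn0 : exists2 k, (k <= m)%N & P k != 0).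
Hypothesis QP : forall i j, (i <= m)%N -> (j <= m)%N -> Q i *m P j = Q j *m P i.

Lemma commuting_middle : b = (c + m)%N \/ b = (a + m)%N.
Proof.
have [q [qm Eq _ _]] := tensor_triangle hwC hwB QT Qn0.
have [p [pm Ep _ _]] := tensor_triangle hwB hwA PT Pn0.
case: (posnP q) => [q0|q0]; first by left; lia.
case: (ltnP p m) => [pm'|mp]; last by right; lia.
pose u := wC *m Q m; have u0 : u != 0 by apply: tensor_hw_Pm hwC QT Qn0.
have Qmf i : fpow fC i wC *m Q m = fpow fB i u.
  elim: i => [|i IH]; first by rewrite !fpow0.
  have [_ _ Qf] := QT (leqnn m); rewrite subnn scale0r addr0 in Qf.
  by rewrite !fpowS -mulmxA -Qf mulmxA IH.
have uP i : (i < q)%N -> fpow fB i u *m P 0%N = 0.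
  move=> iq; rewrite -Qmf -mulmxA (QP (leqnn m) (leq0n m)) mulmxA.
  by rewrite (tensor_weight_out hwC hwB QT) ?mul0mx // => j jb; apply/eqP; lia.
have contra r k : (r <= b)%N -> (r == b) || (b + m <= a + 2 * r)%N ->
    forall v, v != 0 -> v = k *: fpow fB r wB -> v *m P 0%N <> 0.
  move=> rb rhi v v0 vE; have := tensor_fpow_neq0 hwB hwA PT Pn0 rb rhi.
  move=> nz; apply/eqP; rewrite vE -scalemxAl scaler_eq0 (negPf nz) orbF.
  by apply: contraNneq v0 => k0; rewrite vE k0 scale0r.
have [y0|y0] := eqVneq (fpow fB q.-1 u) 0.
  have ex : exists i, fpow fB i u == 0 by exists q.-1; rewrite y0.
  case: (ex_minnP ex) => [[|r]]; first by rewrite fpow0 (negPf u0).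
  move=> /eqP yf minr; rewrite fpowS in yf.
  have [k E] := hw_ker_f charF0 hwB yf.
  case: (contra b k _ _ _ _ E); rewrite ?eqxx //.
    by apply/negP => /minr; rewrite ltnn.
  have rq : (r.+1 <= q.-1)%N by apply: minr; rewrite y0.
  by apply: uP; lia.
have : exists k, fpow fB q.-1 u = k *: fpow fB m.-1 wB.
  by rewrite -Qmf; apply: (tensor_weight hwC hwB QT (leqnn m)); lia.
case=> k E; case: (leqP m.-1 b) => mb.
  case: (contra m.-1 k _ _ _ y0 E); rewrite ?uP //; last by lia.
  by apply/orP; right; lia.
by move: y0; rewrite E (hw_fpow_big hwB mb) scaler0 eqxx.
Qed.

Lemma commuting_not_peak : odd m -> ~ (b = (c + m)%N /\ b = (a + m)%N).
Proof.
move=> om [bc ba].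
have [q [qm Eq w0 _]] := tensor_triangle hwC hwB QT Qn0.
have [p [pm Ep w1 Plt]] := tensor_triangle hwB hwA PT Pn0.
have q0 : q = 0%N by lia.
have pmE : p = m by lia.
subst q p; pose y := wC *m Q 0%N.
have Qe k : (k <= m)%N -> wC *m Q k *m eB = k%:R *: (wC *m Q k.-1).
  move=> km; have [_ E _] := QT km.
  by rewrite -mulmxA E mulmxDr mulmxA (hw_e hwC) mul0mx add0r -scalemxAr.
have [k0 Ey] : exists k, y = k *: wB.
  by apply: (hw_ker_e charF0 hwB); rewrite /y Qe // scale0r.
have [k1 E1] : exists k, wC *m Q m = k *: fpow fB m wB.
  rewrite -[X in X *m _](fpow0 fC); apply: (tensor_weight hwC hwB QT (leqnn m)); lia.
have QeX k : (k <= m)%N -> wC *m Q m *m eB ^+ k = (\prod_(i < k) (m - i)%:R) *: (wC *m Q (m - k)%N).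
  elim: k => [|k IH] km; first by rewrite expr0 mulmx1 big_ord0 scale1r subn0.
  rewrite exprSr mulmxA (IH (ltnW km)) -scalemxAl Qe ?leq_subr // scalerA big_ord_recr /=.
  by rewrite subnS.
have feX k : (k <= m)%N -> fpow fB m wB *m eB ^+ k =
    (\prod_(i < k) ((m - i) * (b - (m - i).-1))%:R) *: fpow fB (m - k) wB.
  elim: k => [|k IH] km; first by rewrite expr0 mulmx1 big_ord0 scale1r subn0.
  rewrite exprSr mulmxA (IH (ltnW km)) -scalemxAl.
  have E : (m - k = (m - k.+1).+1)%N by lia.
  have fe := hw_fe hwB (m - k.+1)%N; rewrite -E in fe.
  by rewrite fe scalerA big_ord_recr /= -subnS natrM [(b - _)%:R]natrB //; lia.
have e1 : k1 * (\prod_(i < m) ((m - i) * (b - (m - i).-1))%:R) = (\prod_(i < m) (m - i)%:R) * k0 .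
  have := QeX m (leqnn m); rewrite E1 -scalemxAl feX // subnn -/y Ey fpow0 !scalerA.
  move/eqP; rewrite -subr_eq0 -scalerBl scaler_eq0 (negPf (hw_neq0 hwB)) orbF subr_eq0.
  by move/eqP.
have fP i : (i <= m)%N ->
    fpow fB i wB *m P (m - i)%N = ((-1) ^+ i * \prod_(j < i) j.+1%:R) *: (wB *m P m).
  elim: i => [|i IH] im; first by rewrite fpow0 subn0 big_ord0 mulr1 scale1r.
  have [_ _ Pf] := PT (leq_subr i.+1 m).
  have := congr1 (mulmx (fpow fB i wB)) Pf; rewrite mulmxA mulmxDr mulmxA -fpowS.
  rewrite (tensor_weight_out hwB hwA PT) ?leq_subr //; last by move=> j ja; apply/eqP; lia.
  rewrite mul0mx -scalemxAr; have -> : (m - i.+1).+1 = (m - i)%N by lia.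
  rewrite IH ?(ltnW im) // => /esym/eqP; rewrite addr_eq0 => /eqP ->.
  rewrite scalerA -scaleNr subKn // big_ord_recr /= exprS; congr (_ *: _); ring.
have := congr1 (mulmx wC) (QP (leqnn m) (leq0n m)); rewrite !mulmxA E1 -/y Ey -!scalemxAl.
have := fP m (leqnn m); rewrite subnn => ->; rewrite scalerA => /eqP.
rewrite -subr_eq0 -scalerBl scaler_eq0 (negPf w1) orbF -signr_odd om expr1 mulN1r.
have -> : \prod_(j < m) j.+1%:R = \prod_(i < m) (m - i)%:R :> F.
  rewrite (reindex_inj rev_ord_inj) /=; apply: eq_bigr => i _.
  by congr (_%:R); have := ltn_ord i; lia.
have e2 : (\prod_(i < m) ((m - i) * (b - (m - i).-1))%:R) =
   (\prod_(i < m) (m - i)%:R) * \prod_(i < m) (b - (m - i).-1)%:R :> F.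
  by rewrite -big_split; apply: eq_bigr => i _; rewrite natrM.
have Pn0' : \prod_(i < m) (m - i)%:R != 0 :> F.
  by apply/prodf_neq0 => i _; rewrite natF_eq0 // subn_eq0 -ltnNge.
have {}e1 : k0 = k1 * \prod_(i < m) (b - (m - i).-1)%:R.
  by apply: (mulfI Pn0'); rewrite -e1 e2; ring.
have k1n0 : k1 != 0.
  apply: contraNneq w0 => k1z.
  by rewrite -/y Ey e1 k1z mul0r scale0r.
rewrite {}e1 -mulrBr mulf_eq0 (negPf k1n0) /= -opprD oppr_eq0.
rewrite -!(big_morph _ (natrM _) (erefl 1%:R)) -natrD natF_eq0 //.
rewrite addn_eq0 => /andP[+ _]; rewrite -(natF_eq0 charF0).
by rewrite (big_morph _ (natrM _) (erefl 1%:R)) (negPf Pn0').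
Qed.

End Two.
End Tensor.

Section Heisenberg.
Variable F : fieldType.
Hypothesis charF0 : [pchar F] =i pred0.

Section NoExtension.
Variables (N : nat) (e h f : 'M[F]_N) (L : 'M[F]_N).
Hypothesis rep : sl2_rep e h f.

Lemma sl2_subquotient r (T W : 'M[F]_N) (B : 'M_(r, N)) C :
  subquotient T W B C -> acts_stable [:: e; h; f] T -> acts_stable [:: e; h; f] W ->
  sl2_rep (B *m e *m C) (B *m h *m C) (B *m f *m C).
Proof.
move=> sq /and4P[Te Th Tf _] /and4P[We Wh Wf _]; have [eh fh fe] := rep.
split; rewrite !(subquotient_stable_mul sq) //.
- by rewrite eh mulmxDr mulmxDl -scalemxAr -scalemxAl.
- by rewrite fh mulmxBr mulmxBl -scalemxAr -scalemxAl.
- by rewrite fe mulmxDr mulmxDl.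
Qed.

(* The case of Weyl's theorem that is needed: L would be the only proper submodule. *)
Lemma sl2_not_uniserial2 :
  acts_stable [:: e; h; f] L -> L != 0 -> ~~ row_full L ->
  (forall U, acts_stable [:: e; h; f] U -> U != 0 -> (L <= U)%MS) ->
  (forall U, acts_stable [:: e; h; f] U -> (L <= U)%MS -> (U <= L)%MS \/ row_full U) ->
  False.
Proof.
move=> sL L0 Lf minL maxL; have [eh fh fe] := rep.
have s0 : acts_stable [:: e; h; f] (0 : 'M_N).
  by apply/allP => A _; rewrite mul0mx.
have s1 : acts_stable [:: e; h; f] (1%:M : 'M_N).
  by apply/allP => A _; rewrite submx1.
have [r1 [B1 [C1 [_ sq1]]]] := subquotient_exists (sub0mx _ L).
have [r2 [B2 [C2 [_ sq2]]]] := subquotient_exists (submx1 L).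
have [|a [w hw1]] := hw_rep_exists charF0 (sl2_subquotient sq1 s0 sL) _.
  apply: (subquotient_irreducible sq1 s0 sL); last by rewrite submx0.
  move=> U sU _ _; have [->|U0] := eqVneq U 0; [by left|by right; apply: minL].
have [|b [u hw2]] := hw_rep_exists charF0 (sl2_subquotient sq2 sL s1) _.
  apply: (subquotient_irreducible sq2 sL s1); last by rewrite sub1mx.
  by move=> U sU LU _; rewrite sub1mx; apply: maxL.
have [_ B1L B1C1 _ H1] := sq1; have [_ _ B2C2 LC2 H2] := sq2.
set e1 := B1 *m e *m C1 in hw1; set h1 := B1 *m h *m C1 in hw1; set f1 := B1 *m f *m C1 in hw1.
have inL (v : 'rV_N) : (v <= L)%MS -> v = v *m C1 *m B1.
  by move=> /H1; rewrite submx0 subr_eq0 => /eqP.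
have B1A (A : 'M_N) (v : 'rV_r1) : stablemx L A -> v *m B1 *m A = v *m (B1 *m A *m C1) *m B1.
  move=> sA; rewrite [LHS]inL ?mulmxA //; apply: submx_trans sA.
  by rewrite submxMr // (submx_trans (submxMl _ _) B1L).
case/and4P: (sL) => sLe sLh sLf _.
have B1e (v : 'rV_r1) : v *m B1 *m e = v *m e1 *m B1 by apply: B1A.
have B1h (v : 'rV_r1) : v *m B1 *m h = v *m h1 *m B1 by apply: B1A.
have B1f i v : fpow f i (v *m B1) = fpow f1 i v *m B1.
  by elim: i => [|i IH]; rewrite ?fpow0 // !fpowS IH B1A.
clearbody e1 h1 f1.
have B1inj (v : 'rV_r1) v' : v *m B1 = v' *m B1 -> v = v'.
  by move=> E; rewrite -[v]mulmx1 -[v']mulmx1 -B1C1 !mulmxA E.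
have inL' (v : 'rV_N) : v *m C2 = 0 -> (v <= L)%MS.
  by move=> z; have := H2 _ v (submx1 _); rewrite z mul0mx subr0.
have C2A (A : 'M_N) (v : 'rV_N) : stablemx L A -> v *m A *m C2 = v *m C2 *m (B2 *m A *m C2).
  move=> sA; rewrite (subquotient_mul sq2) ?submx1 //.
  by have /submxP[D ->] := sA; rewrite -mulmxA LC2 mulmx0.
pose w' := w *m B1; have w'e : w' *m e = 0 by rewrite B1e (hw_e hw1) mul0mx.
have w'h : w' *m h = a%:R *: w' by rewrite B1h (hw_h hw1) scalemxAl.
have w'L : (w' <= L)%MS by rewrite (submx_trans (submxMl _ _) B1L).
(* A lift of u can be corrected by L, up to which e v matters only modulo e L. *)
have [v [k [vC2 ve]]] : exists v k, v *m C2 = u /\ v *m e = k *: (fpow f1 a w *m B1).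
  have ueL : (u *m B2 *m e <= L)%MS.
    by apply: inL'; rewrite C2A // -[u *m B2 *m C2]mulmxA B2C2 mulmx1 (hw_e hw2).
  have [k [t E]] := hw_mod_im_e charF0 hw1 (u *m B2 *m e *m C1).
  exists (u *m B2 - t *m B1), k; split.
    have /submxP[D ->] := B1L.
    by rewrite mulmxBl -!mulmxA B2C2 mulmx1 LC2 !mulmx0 subr0.
  by rewrite mulmxBl [u *m B2 *m e]inL // E mulmxDl B1e addrK scalemxAl.
have [l vh] : exists l, v *m h = b%:R *: v + l *m B1.
  exists ((v *m h - b%:R *: v) *m C1); rewrite -inL; first by rewrite addrC subrK.
  by apply: inL'; rewrite mulmxBl C2A // -scalemxAl vC2 (hw_h hw2) subrr.
have ab0 : (a + b + 2)%:R != 0 :> F by rewrite natF_eq0 // addn2.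
have k0 : k = 0.
  set y := fpow f1 a w *m B1 in ve.
  have veh : v *m e *m h = (k * (a%:R - (2 * a)%:R)) *: y.
    by rewrite ve -scalemxAl B1h (hw_fh hw1) -scalemxAl scalerA.
  have vhe : v *m h *m e = (b%:R * k) *: y + l *m e1 *m B1.
    by rewrite vh mulmxDl B1e -scalemxAl ve scalerA.
  have E : l *m e1 = (- (k * (a + b + 2)%:R)) *: fpow f1 a w.
    apply: B1inj; rewrite -scalemxAl -/y.
    have := congr1 (mulmx v) eh; rewrite mulmxDr !mulmxA veh vhe -scalemxAr ve scalerA.
    rewrite addrAC -scalerDl => /esym/(canRL (addKr _)) ->.
    by rewrite -scaleNr -scalerDl; congr (_ *: _); ring.
  have /eqP := hw_lowest_notin_im_e charF0 hw1 E.
  by rewrite oppr_eq0 mulf_eq0 (negPf ab0) orbF => /eqP.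
rewrite {}k0 scale0r in ve.
have [c lc] : exists c, l = c *: w.
  apply: (hw_ker_e charF0 hw1); apply: B1inj; rewrite mul0mx -B1e.
  have -> : l *m B1 = v *m h - b%:R *: v by rewrite vh addrC addKr.
  rewrite mulmxBl -scalemxAl ve scaler0 subr0 -mulmxA.
  have -> : h *m e = e *m h - 2%:R *: e by rewrite eh addrK.
  by rewrite mulmxBr -scalemxAr mulmxA ve mul0mx scaler0 subr0.
rewrite {}lc -scalemxAl -/w' in vh.
have u0 := hw_neq0 hw2.
have [v' [v'C2 v'e v'h]] : exists v', [/\ v' *m C2 = u, v' *m e = 0 & v' *m h = b%:R *: v'].
  have [ab|ab] := eqVneq a b; last first.
    have ab' : b%:R - a%:R != 0 :> F.
      by rewrite subr_eq0; apply: contra ab => /eqP/(natF_inj charF0)->.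
    exists (v + (c / (b%:R - a%:R)) *: w'); split.
    - have /submxP[D E] := w'L.
      by rewrite mulmxDl -scalemxAl E -mulmxA LC2 mulmx0 scaler0 addr0.
    - by rewrite mulmxDl -scalemxAl ve w'e scaler0 addr0.
    rewrite mulmxDl -scalemxAl vh w'h scalerDr !scalerA -addrA -scalerDl.
    by congr (_ + _ *: _); field.
  exists v; split=> //; suff c0 : c = 0 by rewrite vh c0 scale0r addr0.
  have yL : (fpow f a.+1 v <= L)%MS.
    apply: inL'; have -> i : fpow f i v *m C2 = fpow (B2 *m f *m C2) i u.
      by elim: i => [|i IH]; rewrite ?fpow0 // !fpowS C2A // IH.
    by rewrite ab (hw_top hw2).
  have := fpow_mule a rep ve; rewrite vh ab addrAC subrr add0r -ab.
  rewrite [fpow f a.+1 v]inL // B1e /fpow -scalemxAl -/(fpow f a w') B1f scalerA scalemxAl.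
  move/B1inj/(hw_lowest_notin_im_e charF0 hw1)/eqP.
  by rewrite mulf_eq0 natF_eq0 // => /eqP.
have v'0 : v' != 0 by apply: contra_neq u0 => E; rewrite -v'C2 E mul0mx.
have hw : hw_rep e h f b v'.
  apply: hw_rep_of_vector => // U sU vU.
  have U0 : U != 0 by apply: contraNneq v'0 => E; rewrite -submx0 -E.
  case: (maxL _ sU (minL _ sU U0)) => // UL; case/eqP: u0.
  by have /submxP[D E] := submx_trans vU UL; rewrite -v'C2 E -mulmxA LC2 mulmx0.
have [k' E] := hw_ker_e charF0 hw w'e.
case/eqP: (hw_neq0 hw1); apply: B1inj; rewrite -/w' mul0mx E.
suff -> : k' = 0 by rewrite scale0r.
apply/eqP; apply: contraNT u0 => k'0; rewrite -v'C2.
have /submxP[D E'] := w'L.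
have -> : v' = k'^-1 *: w' by rewrite E scalerA mulVf // scale1r.
by rewrite -scalemxAl E' -mulmxA LC2 mulmx0 scaler0.
Qed.

End NoExtension.
End Heisenberg.

Section HeisenbergModules.
Variable F : fieldType.
Hypothesis charF0 : [pchar F] =i pred0.
Variable m : nat.
Hypothesis m_odd : odd m.

Definition pairing (i : nat) : F := (-1) ^+ i * (i`!)%:R * ((m - i)`!)%:R.

(* The relations of Defs.v for the transposed matrices, which act on row vectors:
   [A, B] = C becomes B^T A^T = A^T B^T + C^T. *)
Record heis_rep d (e h f : 'M[F]_d) (x : nat -> 'M[F]_d) (z : 'M[F]_d) : Prop := HeisRep {
  heis_sl2 : sl2_rep e h f;
  heis_x : tensor_op m e h f e h f x;
  heis_z : forall A, A \in [:: e; h; f] -> A *m z = z *m A;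
  heis_xz : forall k, (k <= m)%N -> x k *m z = z *m x k;
  heis_xx : forall i j, (i <= m)%N -> (j <= m)%N ->
    x j *m x i = x i *m x j + (if i + j == m then pairing i else 0) *: z }.

Definition heis_acts d (e h f : 'M[F]_d) (x : nat -> 'M[F]_d) (z : 'M[F]_d) :=
  [:: e; h; f; z] ++ [seq x k | k <- iota 0 m.+1].

Lemma heis_actsP d (e h f : 'M[F]_d) x z (U : 'M_d) :
  reflect ([/\ acts_stable [:: e; h; f] U, stablemx U z &
             forall k, (k <= m)%N -> stablemx U (x k)])
    (acts_stable (heis_acts e h f x z) U).
Proof.
apply: (iffP allP) => [H|[/allP sl sz sx] A].
  split; [apply/allP => A Al| |move=> k km]; apply: H; rewrite mem_cat.
  - by move: Al; rewrite !inE => /or3P[] ->; rewrite ?orbT.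
  - by rewrite !inE eqxx !orbT.
  - by rewrite map_f ?orbT // mem_iota.
rewrite mem_cat => /orP[|/mapP[k]]; last by rewrite mem_iota => km ->; apply: sx.
rewrite !inE => /or4P[] /eqP-> //; apply: sl; rewrite !inE eqxx ?orbT //.
Qed.

Lemma pairing_neq0 i : pairing i != 0.
Proof. by rewrite /pairing !mulf_neq0 ?signr_eq0 // natF_eq0 // -lt0n fact_gt0. Qed.

Lemma weight_neq0 k : (m%:R - (2 * k)%:R : F) != 0.
Proof.
rewrite subr_eq0; apply/eqP => /(natF_inj charF0) E.
by move: m_odd; rewrite E oddM.
Qed.

Lemma heis_irreducible0 d (e h f : 'M[F]_d) x z :
  heis_rep e h f x z -> irreducible_acts (heis_acts e h f x z) ->
  z = 0 /\ forall k, (k <= m)%N -> x k = 0.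
Proof.
move=> rep [d0 irr]; have [[eh fh fe] xT ze zx xx] := rep.
have z0 : z = 0.
  have cz k : (k <= m)%N -> forall j, x k *m z ^+ j = z ^+ j *m x k.
    move=> km; elim=> [|j IH]; first by rewrite expr0 mulmx1 mul1mx.
    by rewrite exprSr mulmxA IH -mulmxA zx // mulmxA.
  have trz k : \tr (z ^+ k.+1) = 0.
    have xx0 := xx 0%N m (leq0n _) (leqnn _); rewrite add0r eqxx in xx0.
    have E : pairing 0 *: z ^+ k.+1 = x m *m x 0%N *m z ^+ k - x 0%N *m x m *m z ^+ k.
      by rewrite exprS xx0 mulmxDl addrC addKr -scalemxAl.
    have := congr1 mxtrace E; rewrite mxtraceZ linearB /=.
    rewrite -mulmxA cz // mulmxA mxtrace_mulC !mulmxA subrr => /eqP.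
    by rewrite mulf_eq0 (negPf (pairing_neq0 0)) => /eqP.
  have K0 := det0_ker (det0_of_trace_powers charF0 d0 trz).
  have sK : acts_stable (heis_acts e h f x z) (kermx z).
    have st A : A *m z = z *m A -> stablemx (kermx z) A.
      by move=> E; apply/sub_kermxP; rewrite -mulmxA E mulmxA mulmx_ker mul0mx.
    apply/heis_actsP; split; [apply/allP => A /ze; exact: st| exact: st|].
    by move=> k /zx/st.
  case: (irr _ sK) => [E|/submx_full fK]; first by rewrite E eqxx in K0.
  by have /sub_kermxP := fK _ 1%:M; rewrite mul1mx.
split=> //; subst z.
have nil k : (k <= m)%N -> exists r, x k ^+ r = 0.
  by move=> /xT[xh _ _]; apply: nilpotent_of_weight charF0 (weight_neq0 k) xh.
have comm i j : (i <= m)%N -> (j <= m)%N -> x j *m x i = x i *m x j.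
  by move=> im jm; rewrite (xx i j im jm) scaler0 addr0.
have [v v0 vx] : exists2 v : 'rV_d, v != 0 & forall k, (k <= m)%N -> v *m x k = 0.
  suff [v v0 vx] : exists2 v : 'rV_d, v != 0 & forall k, (k < m.+1)%N -> v *m x k = 0.
    by exists v.
  elim: {-2}m.+1 (leqnn m.+1) => [_|k IH km].
    exists (const_mx 1) => //; apply/eqP => /rowP/(_ (Ordinal d0)).
    by rewrite !mxE => /eqP; rewrite oner_eq0.
  have [v v0 vx] := IH (ltnW km); have [r xr] := nil _ km.
  have [j vj vj1] := nilpotent_step xr v0.
  exists (v *m x k ^+ j) => // i; rewrite ltnS leq_eqVlt => /predU1P[->//|ik].
  rewrite -mulmxA; have -> : x k ^+ j *m x i = x i *m x k ^+ j; last first.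
    by rewrite mulmxA vx ?mul0mx.
  have im : (i <= m)%N by rewrite -ltnS (ltn_trans ik).
  elim: j {vj vj1} => [|j IHj]; first by rewrite expr0 mulmx1 mul1mx.
  by rewrite exprSr -mulmxA (comm i k) // mulmxA IHj mulmxA.
pose K := (\bigcap_(k < m.+1) kermx (x k))%MS.
have KP (u : 'rV_d) : reflect (forall k, (k <= m)%N -> u *m x k = 0) (u <= K)%MS.
  apply: (iffP sub_bigcapmxP) => [H k km|H k _].
    by apply/sub_kermxP; apply: (H (Ordinal (km : (k < m.+1)%N))).
  by apply/sub_kermxP; apply: H; rewrite -ltnS.
have x1 k : (k <= m)%N -> forall u : 'rV_d, (forall k, (k <= m)%N -> u *m x k = 0) ->
    k%:R *: (u *m x k.-1) = 0 /\ (m - k)%:R *: (u *m x k.+1) = 0.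
  move=> km u H; split; first by rewrite H ?scaler0 // (leq_trans (leq_pred _)).
  move: km; rewrite leq_eqVlt => /predU1P[->|km]; first by rewrite subnn scale0r.
  by rewrite H ?scaler0.
have sK : acts_stable (heis_acts e h f x 0) K.
  have st A : (forall u : 'rV_d, (forall k, (k <= m)%N -> u *m x k = 0) ->
      forall k, (k <= m)%N -> u *m A *m x k = 0) -> stablemx K A.
    by move=> H; apply: sub_of_rows => u /KP uK; apply/KP; apply: H.
  apply/heis_actsP; split.
  - apply/and4P; split=> //; apply: st => u uK k km; have [xh xe xf] := xT k km;
      have [u1 u2] := x1 k km u uK.
    + have := congr1 (mulmx u) xe; rewrite mulmxDr -scalemxAr u1 addr0 !mulmxA.
      by rewrite uK // mul0mx.
    + have := congr1 (mulmx u) xh; rewrite mulmxDr -scalemxAr uK // scaler0 addr0 !mulmxA.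
      by rewrite uK // mul0mx.
    + have := congr1 (mulmx u) xf; rewrite mulmxDr -scalemxAr u2 addr0 !mulmxA.
      by rewrite uK // mul0mx.
  - by rewrite mulmx0 sub0mx.
  - by move=> i im; apply: st => u uK k km; rewrite uK // mul0mx.
case: (irr _ sK) => [E|fK k km].
  have /KP : forall k, (k <= m)%N -> v *m x k = 0 by [].
  by rewrite E submx0 (negPf v0).
apply/row_matrixP => i; rewrite row0 rowE.
by have /KP -> := submx_full (delta_mx 0 i : 'rV_d) fK.
Qed.

Lemma heis_subquotient d r (e h f : 'M[F]_d) x z (T W : 'M[F]_d) (B : 'M_(r, d)) C :
  heis_rep e h f x z -> subquotient T W B C ->
  acts_stable (heis_acts e h f x z) T -> acts_stable (heis_acts e h f x z) W ->
  heis_rep (B *m e *m C) (B *m h *m C) (B *m f *m C) (fun k => B *m x k *m C) (B *m z *m C).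
Proof.
move=> [rep xT ze zx xx] sq /heis_actsP[Ts Tz Tx] /heis_actsP[Ws Wz Wx].
case/and4P: (Ts) => Te Th Tf _; case/and4P: (Ws) => We Wh Wf _.
split.
- exact: sl2_subquotient sq Ts Ws.
- move=> k km; have [xh xe xf] := xT k km; have Txk := Tx k km; have Wxk := Wx k km.
  split; rewrite !(subquotient_stable_mul sq) //.
  + by rewrite xh mulmxDr mulmxDl -scalemxAr -scalemxAl.
  + by rewrite xe mulmxDr mulmxDl -scalemxAr -scalemxAl.
  + by rewrite xf mulmxDr mulmxDl -scalemxAr -scalemxAl.
- move=> A; rewrite !inE => /or3P[] /eqP->; rewrite !(subquotient_stable_mul sq) //;
    by rewrite ze // !inE eqxx ?orbT.
- by move=> k km; rewrite !(subquotient_stable_mul sq) ?zx ?Tx ?Wx.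
move=> i j im jm; rewrite !(subquotient_stable_mul sq) ?Tx ?Wx // xx //.
by rewrite mulmxDr mulmxDl -scalemxAr -scalemxAl.
Qed.

End HeisenbergModules.

Lemma no_return_of_steps (m j : nat) (a : nat -> nat) : odd m -> (0 < j)%N ->
  (forall i, (i < j)%N -> exists2 p, (p <= m)%N & (a i + 2 * p = a i.+1 + m)%N) ->
  (forall i, (i.+1 < j)%N -> (a i.+1 = a i.+2 + m)%N \/ (a i.+1 = a i + m)%N) ->
  (forall i, (i.+1 < j)%N -> ~ ((a i.+1 = a i.+2 + m)%N /\ (a i.+1 = a i + m)%N)) ->
  a j <> a 0%N.
Proof.
move=> om j0 step mid peak.
have m0 : (0 < m)%N by case: m om {step mid peak}.
have odd_step i : (i < j)%N -> a i != a i.+1.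
  move=> /step[p _ E]; apply: contraTneq om => E'; move: E; rewrite E' => /addnI <-.
  by rewrite oddM.
(* The steps are: first +m, then one step t with 0 < |t| < m, then -m,
   where any of the three parts may be missing. *)
pose apart i := forall k, a i <> (a 0 + k * m)%N /\ a 0%N <> (a i + k * m)%N.
suff H i : (i < j)%N -> (a i.+1 = (a i + m)%N /\ a i.+1 = (a 0 + i.+1 * m)%N) \/
    (a i.+1 <> (a i + m)%N /\ ((a i.+1 < a 0)%N \/ apart i.+1)).
  case: j j0 {step mid peak odd_step} H => // j _ /(_ j (ltnSn j)).
  case=> [[_ ->]|[_ [lt|ap]]] E; first by move: E; rewrite mulSn; lia.
    by rewrite E ltnn in lt.
  by case: (ap 0%N); rewrite mul0n addn0 E.
elim: i => [|i IH] ij.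
  have [p pm E] := step _ ij; have := odd_step _ ij => /eqP ne.
  have [E1|ne1] := eqVneq (a 1%N) (a 0 + m)%N; first by left; rewrite mul1n.
  right; split; first exact/eqP.
  case: (ltnP (a 1%N) (a 0%N)) => [|le]; [by left|right].
  move/eqP: ne1 => ne1 [|k]; first by rewrite mul0n !addn0; split=> // /esym.
  by rewrite mulSn; split; lia.
have ij' : (i < j)%N by apply: ltnW.
have [p pm E] := step _ ij; have := odd_step _ ij => /eqP ne.
have := mid _ ij; have := peak _ ij.
case: (IH ij') => [[E1 E2] pk _|[n1 H] _]; last first.
  case=> // E1; right; split; first by lia.
  case: H => [lt|ap]; [left; lia|right=> k; split=> E2].
    by case: (ap k.+1) => + _; apply; rewrite mulSn; lia.
  case: k E2 => [|k] E2; first by case: (ap 1%N) => + _; apply; rewrite mul1n; lia.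
  by case: (ap k) => _; apply; rewrite E2 mulSn; lia.
have [E3|/eqP ne3] := eqVneq (a i.+2) (a i.+1 + m)%N.
  by left; split=> //; rewrite E3 E2 [in RHS]mulSn; lia.
right; split=> //; right=> k.
have n4 : a i.+1 <> (a i.+2 + m)%N by move=> E4; apply: pk.
have i1 : (m <= i.+1 * m)%N by rewrite leq_pmull.
split=> E5; last by apply: n4; lia.
case: (ltngtP k i.+1) => ki.
- by have := leq_mul2r m k.+1 i.+1; rewrite ki orbT mulSn => E6; apply: n4; lia.
- by have := leq_mul2r m i.+2 k; rewrite ki orbT [(i.+2 * m)%N]mulSn => E6; apply: ne3; lia.
by apply: ne; rewrite E5 ki E2.
Qed.

Section Uniserial.
Variable F : fieldType.
Hypothesis charF0 : [pchar F] =i pred0.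

Record composition_chain d (acts : seq 'M[F]_d) (s : nat -> 'M[F]_d) (l : nat) : Prop :=
  CompositionChain {
    chain0 : s 0%N = 0;
    chain_full : row_full (s l);
    chain_stable : forall i, (i <= l)%N -> acts_stable acts (s i);
    chain_le : forall i, (i < l)%N -> (s i <= s i.+1)%MS;
    chain_lt : forall i, (i < l)%N -> ~~ (s i.+1 <= s i)%MS;
    chain_next : forall U i, acts_stable acts U -> (i < l)%N ->
      (s i <= U)%MS -> ~~ (U <= s i)%MS -> (s i.+1 <= U)%MS }.

Section Chain.
Variables (d : nat) (acts : seq 'M[F]_d) (s : nat -> 'M[F]_d) (l : nat).
Hypothesis cc : composition_chain acts s l.

Lemma chain_mono i j : (i <= j)%N -> (j <= l)%N -> (s i <= s j)%MS.
Proof.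
move=> ij; rewrite -(subnKC ij); elim: (j - i)%N => [|k IH] kl; first by rewrite addn0.
by rewrite addnS in kl *; rewrite (submx_trans (IH (ltnW kl))) ?(chain_le cc).
Qed.

Lemma chain_eq U : acts_stable acts U ->
  exists2 j, (j <= l)%N & (s j <= U)%MS && (U <= s j)%MS.
Proof.
move=> sU; have ex : exists j, (j <= l)%N && (s j <= U)%MS.
  by exists 0%N; rewrite (chain0 cc) sub0mx.
have ub j : (j <= l)%N && (s j <= U)%MS -> (j <= l)%N by case/andP.
case: (ex_maxnP ex ub) => j /andP[jl jU] maxj; exists j; rewrite // jU /=.
case: (ltngtP j l) jl => // [jl _|-> _]; last by rewrite submx_full ?(chain_full cc).
apply/negPn/negP => nU; have := maxj j.+1.
by rewrite jl (chain_next cc sU jl jU nU) ltnn => /(_ isT).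
Qed.

Lemma chain_subquotient_irreducible i r (B : 'M_(r, d)) C : (i < l)%N ->
  subquotient (s i) (s i.+1) B C -> irreducible_acts [seq B *m A *m C | A <- acts].
Proof.
move=> il sq; apply: (subquotient_irreducible sq).
- exact: (chain_stable cc (ltnW il)).
- exact: (chain_stable cc il).
- move=> U sU sU1 _; have [|nU] := boolP (U <= s i)%MS; first by left.
  by right; apply: (chain_next cc sU il).
exact: (chain_lt cc il).
Qed.

Variable z : 'M[F]_d.
Hypothesis zc : forall A, A \in acts -> A *m z = z *m A.

Lemma chain_kernel_image j i : (s j <= kermx z)%MS -> (kermx z <= s j)%MS ->
  (j + i <= l)%N -> (s (j + i)%N *m z <= s i)%MS && (s i <= s (j + i)%N *m z)%MS.
Proof.
move=> jK Kj; elim: i => [|i IH] il.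
  by rewrite addn0 (chain0 cc) sub0mx andbT submx0; apply/eqP/sub_kermxP.
rewrite addnS in il *; have {IH}/andP[IH1 IH2] := IH (ltnW il).
have il' : (i < l)%N by apply: leq_trans il; rewrite ltnS leq_addl.
have stz U : acts_stable acts U -> acts_stable acts (U *m z).
  move=> /allP sU; apply/allP => A Aa; rewrite -mulmxA -(zc Aa) mulmxA.
  by apply: submxMr; apply: sU.
have le := chain_le cc il; have lt := chain_lt cc il.
have up : (s i.+1 <= s (j + i).+1 *m z)%MS.
  apply: (chain_next cc _ il'); first by apply/stz/(chain_stable cc).
    exact: submx_trans IH2 (submxMr _ le).
  apply: contra lt => lei; have /submxP[D hD] := submx_trans lei IH2.
  rewrite -[s (j + i).+1](subrK (D *m s (j + i)%N)) addmx_sub ?submxMl //.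
  apply: (@submx_trans _ _ _ _ _ _ (s j)); last by rewrite chain_mono ?leq_addr // ltnW.
  by apply: submx_trans Kj; apply/sub_kermxP; rewrite mulmxBl hD mulmxA subrr.
rewrite up andbT; set S := s (j + i).+1 in up *.
pose U := kermx (z *m cokermx (s i.+1)).
have UP k (V : 'M_(k, d)) : (V <= U)%MS = (V *m z <= s i.+1)%MS.
  by rewrite (sameP sub_kermxP eqP) mulmxA -submxE.
have sU : acts_stable acts U.
  apply/allP => A Aa; rewrite UP -mulmxA (zc Aa) mulmxA.
  have /allP/(_ A Aa) := chain_stable cc il'; apply: submx_trans; apply: submxMr.
  by rewrite -UP.
rewrite -UP; apply: (chain_next cc sU il).
  by rewrite UP (submx_trans IH1) ?(chain_le cc).
have /submxP[D hD] := up; apply: contra (chain_lt cc il') => Uj.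
rewrite hD mulmxA; apply: submx_trans IH1; apply: submxMr; apply: submx_trans Uj.
by rewrite UP -mulmxA -hD.
Qed.

Lemma chain_kernel_rank j i : (s j <= kermx z)%MS -> (kermx z <= s j)%MS ->
  (j + i < l)%N -> (\rank (s (j + i).+1) + \rank (s i) = \rank (s (j + i)) + \rank (s i.+1))%N.
Proof.
move=> jK Kj il.
have rk k : (j + k <= l)%N -> (\rank (s k) + \rank (s j) = \rank (s (j + k)))%N.
  move=> kl; rewrite -(mxrank_mul_ker (s (j + k)) z); congr (_ + _)%N.
    by apply/eqP; rewrite eqn_leq !mxrankS //; have /andP[] := chain_kernel_image jK Kj kl.
  apply/eqP; rewrite eqn_leq !mxrankS //; first by rewrite (submx_trans (capmxSr _ _)).
  by rewrite sub_capmx jK chain_mono ?leq_addr.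
by have := rk i (ltnW il); have := rk i.+1; rewrite addnS => /(_ il) <- <-; lia.
Qed.

End Chain.
End Uniserial.

Section Main.
Variable F : fieldType.
Hypothesis charF0 : [pchar F] =i pred0.
Variable m : nat.
Hypothesis m_odd : odd m.
Variables (d : nat) (e h f : 'M[F]_d) (x : nat -> 'M[F]_d) (z : 'M[F]_d).
Hypothesis rep : heis_rep m e h f x z.
Variables (s : nat -> 'M[F]_d) (l : nat).
Hypothesis cc : composition_chain (heis_acts m e h f x z) s l.

Lemma heis_acts_subquotient r (B : 'M[F]_(r, d)) C :
  [seq B *m A *m C | A <- heis_acts m e h f x z] =
  heis_acts m (B *m e *m C) (B *m h *m C) (B *m f *m C) (fun k => B *m x k *m C) (B *m z *m C).
Proof. by rewrite /heis_acts map_cat -map_comp. Qed.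

Lemma layer_radical i r (B : 'M[F]_(r, d)) C : (i < l)%N ->
  subquotient (s i) (s i.+1) B C ->
  B *m z *m C = 0 /\ forall k, (k <= m)%N -> B *m x k *m C = 0.
Proof.
move=> il sq; have irr := chain_subquotient_irreducible cc il sq.
rewrite heis_acts_subquotient in irr.
have rep' := heis_subquotient rep sq (chain_stable cc (ltnW il)) (chain_stable cc il).
exact: (heis_irreducible0 charF0 m_odd rep' irr).
Qed.

Lemma chain_radical i : (i < l)%N ->
  (s i.+1 *m z <= s i)%MS /\ forall k, (k <= m)%N -> (s i.+1 *m x k <= s i)%MS.
Proof.
move=> il; have [r [B [C [_ sq]]]] := subquotient_exists (chain_le cc il).
have [z0 x0] := layer_radical il sq.
have /heis_actsP[_ Tz Tx] := chain_stable cc (ltnW il).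
have /heis_actsP[_ Wz Wx] := chain_stable cc il.
split=> [|k km]; first exact: (subquotient_eq0 sq sq).
by apply: (subquotient_eq0 sq sq); rewrite ?Tx ?Wx ?x0.
Qed.

Lemma z_bracket : pairing F m 0 *: z = x m *m x 0%N - x 0%N *m x m.
Proof.
have := heis_xx rep (leq0n m) (leqnn m); rewrite add0r eqxx => ->.
by rewrite addrC addKr.
Qed.


Lemma chain_z2 i : (i.+1 < l)%N -> (s i.+2 *m z <= s i)%MS.
Proof.
move=> il; have [_ x1] := chain_radical (ltnW il); have [_ x2] := chain_radical il.
have xx k k' : (k <= m)%N -> (k' <= m)%N -> (s i.+2 *m (x k *m x k') <= s i)%MS.
  by move=> km km'; rewrite mulmxA (submx_trans (submxMr _ (x2 k km))) ?x1.
rewrite -[z](scalerK (pairing_neq0 charF0 m 0)) z_bracket -scalemxAr scalemx_sub //.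
by rewrite mulmxBr addmx_sub ?eqmx_opp ?xx.
Qed.

Lemma layer_hw i r (B : 'M[F]_(r, d)) C : (i < l)%N ->
  subquotient (s i) (s i.+1) B C ->
  exists a w, hw_rep (B *m e *m C) (B *m h *m C) (B *m f *m C) a w.
Proof.
move=> il sq; have [z0 x0] := layer_radical il sq.
have [r0 irr] := chain_subquotient_irreducible cc il sq.
have rep' := heis_subquotient rep sq (chain_stable cc (ltnW il)) (chain_stable cc il).
apply: (hw_rep_exists charF0 (heis_sl2 rep')); split=> // U sU; apply: irr.
rewrite heis_acts_subquotient; apply/heis_actsP; split=> [//||k km].
  by rewrite z0 mulmx0 sub0mx.
by rewrite x0 // mulmx0 sub0mx.
Qed.

Lemma step_neq0 i r (B : 'M[F]_(r, d)) C r' (B' : 'M[F]_(r', d)) C' : (i.+1 < l)%N ->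
  subquotient (s i) (s i.+1) B C -> subquotient (s i.+1) (s i.+2) B' C' ->
  exists2 k, (k <= m)%N & B' *m x k *m C != 0.
Proof.
move=> il sq sq'; have il' : (i < l)%N by apply: ltnW.
suff: ~~ [forall k : 'I_m.+1, B' *m x k *m C == 0].
  by case/forallPn => k nz; exists (k : nat); rewrite // -ltnS.
apply/negP => /forallP P0.
have st k : (k <= m)%N -> (s i.+2 *m x k <= s i)%MS.
  move=> km; have [_ x1] := chain_radical il'; have [_ x2] := chain_radical il.
  apply: (subquotient_eq0 sq' sq (x2 k km) (x1 k km)).
  exact: (eqP (P0 (Ordinal (km : (k < m.+1)%N)))).
have le1 := chain_le cc il'; have le2 := chain_le cc il.
have s1 := chain_stable cc (ltnW il'); have s2 := chain_stable cc il'.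
have s3 := chain_stable cc il.
have [N [D [G [_ sqQ]]]] := subquotient_exists (submx_trans le1 le2).
have [_ DW DG TG H] := sqQ.
pose L := <<s i.+1 *m G>>%MS.
have sub0G (k : nat) (v : 'M_(k, d)) : (v <= s i)%MS -> v *m G = 0.
  by move=> /submxP[? ->]; rewrite -mulmxA TG mulmx0.
have Dx k : (k <= m)%N -> D *m x k *m G = 0.
  by move=> km; apply: sub0G; rewrite (submx_trans (submxMr _ DW)) ?st.
have Dz : D *m z *m G = 0.
  by apply: sub0G; rewrite (submx_trans (submxMr _ DW)) ?chain_z2.
have lift U : acts_stable [:: D *m e *m G; D *m h *m G; D *m f *m G] U ->
    acts_stable (heis_acts m e h f x z) (s i + U *m D)%MS.
  move=> sU; apply: (acts_stable_lift sqQ s1 s3).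
  rewrite heis_acts_subquotient; apply/heis_actsP; split=> [//||k km].
    by rewrite Dz mulmx0 sub0mx.
  by rewrite Dx // mulmx0 sub0mx.
have liftG (U : 'M_N) (V : 'M_d) : (V <= s i + U *m D)%MS -> (V *m G <= U)%MS.
  move/(submxMr G)/submx_trans; apply.
  by rewrite addsmxMr addsmx_sub TG sub0mx -mulmxA DG mulmx1 submx_refl.
have LD : (L *m D <= s i.+1)%MS.
  rewrite (eqmxMr _ (genmxE _)) -[_ *m G *m D]opprK eqmx_opp.
  rewrite -[X in (X <= _)%MS](addrK (s i.+1)) [_ + s i.+1]addrC.
  by rewrite addmx_sub ?eqmx_opp // (submx_trans (H _ _ le2)).
apply: (@sl2_not_uniserial2 _ charF0 N _ _ _ L
  (sl2_subquotient (heis_sl2 rep) sqQ _ _)).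
- by case/heis_actsP: s1.
- by case/heis_actsP: s3.
- have stL A : stablemx (s i) A -> stablemx (s i.+1) A -> stablemx L (D *m A *m G).
    move=> sA sA'; rewrite (eqmxMr _ (genmxE _)) genmxE (subquotient_mul sqQ) //.
      exact: submxMr.
    by apply: sub0G.
  case/heis_actsP: s1 => /and4P[? ? ? _] _ _; case/heis_actsP: s2 => /and4P[? ? ? _] _ _.
  by apply/and4P; split=> //; apply: stL.
- apply: contra (chain_lt cc il') => /eqP L0.
  have := H _ _ le2; have -> : s i.+1 *m G = 0; last by rewrite mul0mx subr0.
  by apply/eqP; rewrite -submx0 -L0 genmxE.
- apply: contra (chain_lt cc il) => fL.
  rewrite -[s i.+2](subrK (s i.+2 *m G *m D)) addmx_sub ?(submx_trans (H _ _ (submx_refl _))) //.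
  by apply: submx_trans LD; apply: submxMr; apply: submx_full.
- move=> U /lift sU U0; rewrite genmxE; apply: liftG.
  apply: (chain_next cc sU il'); first exact: addsmxSl.
  apply: contra U0 => /(submx_trans (addsmxSr _ _))/sub0G.
  by rewrite -mulmxA DG mulmx1 => ->.
move=> U /lift sU LU.
have le : (s i.+1 <= s i + U *m D)%MS.
  rewrite -[s i.+1](subrK (s i.+1 *m G *m D)) addmx_sub_adds ?H //.
  by apply: submxMr; apply: submx_trans LU; rewrite genmxE.
have [Ule|nUle] := boolP (s i + U *m D <= s i.+1)%MS.
  left; rewrite genmxE -[U]mulmx1 -DG mulmxA; apply: submxMr.
  exact: submx_trans (addsmxSr _ _) Ule.
right; rewrite -sub1mx -DG; have := chain_next cc sU il le nUle => /liftG.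
by apply: submx_trans; apply: submxMr.
Qed.

Lemma step_tensor i r (B : 'M[F]_(r, d)) C r' (B' : 'M[F]_(r', d)) C' : (i.+1 < l)%N ->
  subquotient (s i) (s i.+1) B C -> subquotient (s i.+1) (s i.+2) B' C' ->
  tensor_op m (B' *m e *m C') (B' *m h *m C') (B' *m f *m C')
     (B *m e *m C) (B *m h *m C) (B *m f *m C) (fun k => B' *m x k *m C).
Proof.
move=> il sq sq' k km; have il' : (i < l)%N by apply: ltnW.
have [_ _ _ TC _] := sq; have [_ BW' _ _ _] := sq'.
have [_ x1] := chain_radical il'; have [_ x2] := chain_radical il.
have sub0C n (v : 'M_(n, d)) : (v <= s i)%MS -> v *m C = 0.
  by move=> /submxP[? ->]; rewrite -mulmxA TC mulmx0.
have post A : stablemx (s i) A -> B' *m x k *m C *m (B *m A *m C) = B' *m (x k *m A) *m C.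
  move=> sA; rewrite (subquotient_mul sq) ?(sub0C _ _ sA) //; first by rewrite !mulmxA.
  by rewrite (submx_trans (submxMr _ BW')) ?x2.
have pre A : stablemx (s i.+2) A -> B' *m A *m C' *m (B' *m x k *m C) = B' *m (A *m x k) *m C.
  move=> sA; rewrite (subquotient_mul sq') ?(sub0C _ _ (x1 k km)) //; first by rewrite !mulmxA.
  exact: (submx_trans (submxMr _ BW') sA).
have /heis_actsP[/and4P[? ? ? _] _ _] := chain_stable cc (ltnW il').
have /heis_actsP[/and4P[? ? ? _] _ _] := chain_stable cc il.
have [xh xe xf] := heis_x rep km.
split; rewrite post ?pre // ?xh ?xe ?xf mulmxDr mulmxDl -scalemxAr -scalemxAl //.
Qed.

Lemma step_comp i r (B : 'M[F]_(r, d)) C r' (B' : 'M[F]_(r', d)) C'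
    r'' (B'' : 'M[F]_(r'', d)) C'' : (i.+2 < l)%N ->
  subquotient (s i) (s i.+1) B C -> subquotient (s i.+1) (s i.+2) B' C' ->
  subquotient (s i.+2) (s i.+3) B'' C'' ->
  forall k k', (k <= m)%N -> (k' <= m)%N ->
  B'' *m x k *m C' *m (B' *m x k' *m C) = B'' *m (x k *m x k') *m C.
Proof.
move=> il sq sq' sq'' k k' km km'; have [_ BW'' _ _ _] := sq''.
have [_ _ _ TC _] := sq.
have [_ x1] := chain_radical (ltnW (ltnW il)); have [_ x2] := chain_radical il.
rewrite (subquotient_mul sq') ?mulmxA //.
  by rewrite (submx_trans (submxMr _ BW'')) ?x2.
by have /submxP[D ->] := x1 k' km'; rewrite -mulmxA TC mulmx0.
Qed.

End Main.

Lemma right_inverse_of_left (F : fieldType) p q (A : 'M[F]_(p, q)) B :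
  p = q -> A *m B = 1%:M -> B *m A = 1%:M.
Proof. by move=> E; case: _ / E A B => A B; apply: mulmx1C. Qed.

Lemma heisenberg_trace (F : fieldType) n0 n1 n2 n3 (c : F)
    (P1 P1' : 'M[F]_(n1, n0)) (P2 P2' : 'M[F]_(n2, n1)) (P3 P3' : 'M[F]_(n3, n2))
    (Z1 : 'M[F]_(n2, n0)) (Z2 : 'M[F]_(n3, n1)) (Y1 : 'M[F]_(n0, n2)) (Y2 : 'M[F]_(n1, n3)) :
  Z1 *m Y1 = 1%:M -> Y2 *m Z2 = 1%:M -> Z2 *m Y2 = 1%:M ->
  Z2 *m P1 = P3 *m Z1 -> Z2 *m P1' = P3' *m Z1 ->
  P2' *m P1 - P2 *m P1' = c *: Z1 -> P3' *m P2 - P3 *m P2' = c *: Z2 ->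
  c * (n2 + n3)%:R = 0.
Proof.
move=> ZY1 YZ2 ZY2 E E' C1 C2.
have slide (P : 'M_(n1, n0)) (Q : 'M_(n3, n2)) : Z2 *m P = Q *m Z1 -> P *m Y1 = Y2 *m Q.
  move=> H; rewrite -[P]mul1mx -YZ2 -[Y2 *m Z2 *m P]mulmxA H -!mulmxA ZY1.
  by rewrite mulmx1.
have := congr1 (fun A => \tr (A *m Y1)) C1; have := congr1 (fun A => \tr (A *m Y2)) C2.
rewrite /= -!scalemxAl ZY1 ZY2 !mxtraceZ !mxtrace1 natrD mulrDr => <- <-.
rewrite !mulmxBl !raddfB /= -(mulmxA P2') (slide _ _ E) -(mulmxA P2 P1') (slide _ _ E').
rewrite -(mulmxA P3') -(mulmxA P3) [\tr (P3' *m _)]mxtrace_mulC [\tr (P3 *m _)]mxtrace_mulC.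
by rewrite !mulmxA addrC subrKA subrr.
Qed.

Section Final.
Variable F : fieldType.
Hypothesis charF0 : [pchar F] =i pred0.
Variable m : nat.
Hypothesis m_odd : odd m.
Variables (d : nat) (e h f : 'M[F]_d) (x : nat -> 'M[F]_d) (z : 'M[F]_d).
Hypothesis rep : heis_rep m e h f x z.
Variables (s : nat -> 'M[F]_d) (l : nat).
Hypothesis cc : composition_chain (heis_acts m e h f x z) s l.

Lemma z_central A : A \in heis_acts m e h f x z -> A *m z = z *m A.
Proof.
rewrite mem_cat => /orP[|/mapP[k]]; last first.
  by rewrite mem_iota => /andP[_ km] ->; apply: (heis_xz rep).
by rewrite !inE => /or4P[] /eqP-> //; apply: (heis_z rep); rewrite !inE eqxx ?orbT.
Qed.

Lemma layer_exists i : (i < l)%N -> exists r (B : 'M[F]_(r, d)) C w,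
  [/\ subquotient (s i) (s i.+1) B C, (r + \rank (s i) = \rank (s i.+1))%N &
  hw_rep (B *m e *m C) (B *m h *m C) (B *m f *m C) (\rank (s i.+1) - \rank (s i)).-1 w].
Proof.
move=> il; have [r [B [C [rk sq]]]] := subquotient_exists (chain_le cc il).
have [a [w hw]] := layer_hw charF0 m_odd rep cc il sq.
exists r, B, C, w; split=> //; suff -> : (\rank (s i.+1) - \rank (s i)).-1 = a by [].
by rewrite -rk addnK (hw_dim charF0 hw).
Qed.

Lemma z0_of_length_gt3 : (3 < l)%N -> z = 0.
Proof.
move=> l3; have sK : acts_stable (heis_acts m e h f x z) (kermx z).
  apply/allP => A Aa; apply/sub_kermxP.
  by rewrite -mulmxA (z_central Aa) mulmxA mulmx_ker mul0mx.
have [j jl /andP[jK Kj]] := chain_eq cc sK.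
case: (ltngtP j l) jl => // [jl _|jl _]; last first.
  apply/eqP; rewrite -[z]mul1mx; apply/eqP/sub_kermxP; apply: submx_trans jK.
  by rewrite submx_full // jl (chain_full cc).
exfalso.
have s2K : (s 2 <= kermx z)%MS.
  apply/sub_kermxP/eqP; rewrite -submx0 -(chain0 cc).
  by apply: (chain_z2 charF0 m_odd rep cc); lia.
have j2 : (2 <= j)%N.
  rewrite leqNgt; apply: contra (chain_lt cc jl) => j2; apply: submx_trans Kj.
  by apply: submx_trans s2K; apply: (chain_mono cc) => //; lia.
have rk0 : \rank (s 0%N) = 0%N by rewrite (chain0 cc) mxrank0.
have zim i : (j + i <= l)%N -> (s (j + i)%N *m z <= s i)%MS && (s i <= s (j + i)%N *m z)%MS.
  exact: (chain_kernel_image cc z_central jK Kj).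
have zrk i := chain_kernel_rank cc z_central jK Kj (i := i).
have rad i (il : (i < l)%N) := chain_radical charF0 m_odd rep cc il.
have bracket k k' : (k <= m)%N -> (k' <= m)%N -> exists c, x k *m x k' = x k' *m x k + c *: z.
  by move=> km km'; eexists; apply: (heis_xx rep).
move: j2; rewrite leq_eqVlt => /orP[/eqP j2|j3].
  subst j; have := zrk 0%N; have := zrk 1%N; rewrite addn0 addn1 rk0.
  have [L0 L1 L2] : [/\ 0 < l, 1 < l & 2 < l]%N by split; lia.
  move=> /(_ l3) rk3 /(_ L2) rk2.
  have [n0 [B0 [C0 [_ [sq0 r0 _]]]]] := layer_exists L0.
  have [n1 [B1 [C1 [_ [sq1 r1 _]]]]] := layer_exists L1.
  have [n2 [B2 [C2 [w2 [sq2 r2 hw2]]]]] := layer_exists L2.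
  have [n3 [B3 [C3 [_ [sq3 r3 _]]]]] := layer_exists l3.
  have [_ BW0 BC0 TC0 _] := sq0; have [_ BW1 BC1 TC1 _] := sq1.
  have [_ BW2 BC2 TC2 _] := sq2; have [_ BW3 BC3 TC3 _] := sq3.
  have n20 : n0 = n2 by lia.
  have n31 : n1 = n3 by lia.
  have sub0C n r i (C : 'M_(d, r)) (v : 'M_(n, d)) : s i *m C = 0 -> (v <= s i)%MS -> v *m C = 0.
    by move=> sC /submxP[? ->]; rewrite -mulmxA sC mulmx0.
  have s2z : s 2 *m z *m C0 = 0.
    by apply: (sub0C _ _ _ _ _ TC0); have /sub_kermxP -> := s2K; rewrite sub0mx.
  have s3z : s 3 *m z *m C1 = 0.
    by apply: (sub0C _ _ _ _ _ TC1); have /andP[] := zim 1%N L2.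
  have s1x k : (k <= m)%N -> s 1%N *m x k *m C0 = 0.
    by move=> km; apply: (sub0C _ _ _ _ _ TC0); have [_ ->] := rad _ L0.
  have inv n i r p (B : 'M_(n, d)) C (D : 'M_(p, d)) G : (2 + i.+1 <= l)%N ->
      subquotient (s (2 + i)%N) (s (2 + i).+1) D G ->
      (B <= s i.+1)%MS -> s (2 + i)%N *m z *m C = 0 ->
      exists Y : 'M_(n, p), Y *m (D *m z *m C) = B *m C :> 'M_(n, r).
    move=> il sq Bs szC; have /andP[_ im] := zim _ il.
    have /submxP[Y E] := submx_trans Bs im; exists (Y *m s (2 + i).+1 *m G).
    by rewrite (subquotient_mul sq) ?submxMl // E addnS mulmxA.
  have [Y1 YZ1] := inv _ 0%N _ _ _ C0 _ _ L2 sq2 BW0 s2z; rewrite BC0 in YZ1.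
  have [Y2 YZ2] := inv _ 1%N _ _ _ C1 _ _ l3 sq3 BW1 s3z; rewrite BC1 in YZ2.
  have ZY1 := right_inverse_of_left n20 YZ1; have ZY2 := right_inverse_of_left n31 YZ2.
  have zP k : (k <= m)%N -> B3 *m z *m C1 *m (B1 *m x k *m C0) = B3 *m x k *m C2 *m (B2 *m z *m C0).
    move=> km; rewrite (subquotient_mul sq1) ?s1x //; last first.
      by apply: submx_trans (submxMr _ BW3) _; have /andP[] := zim 2%N l3.
    rewrite (subquotient_mul sq2) ?s2z //.
      by rewrite -!(mulmxA B3) (heis_xz rep km).
    by apply: submx_trans (submxMr _ BW3) _; have [_ ->] := rad _ l3.
  have comp1 := step_comp charF0 m_odd rep cc L2 sq0 sq1 sq2.
  have comp2 := step_comp charF0 m_odd rep cc l3 sq1 sq2 sq3.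
  have := heisenberg_trace ZY1 YZ2 ZY2 (zP _ (leq0n m)) (zP _ (leqnn m))
    (P2 := B2 *m x 0%N *m C1) (P2' := B2 *m x m *m C1) (c := pairing F m 0).
  rewrite !comp1 ?comp2 // -!mulmxBl -!mulmxBr -(z_bracket rep).
  rewrite -!scalemxAr -!scalemxAl => /(_ erefl erefl)/eqP.
  rewrite mulf_eq0 (negPf (pairing_neq0 charF0 m 0)) natF_eq0 //= addn_eq0.
  by rewrite (hw_dim charF0 hw2).
pose a i := (\rank (s i.+1) - \rank (s i)).-1.
have : a j = a 0%N.
  have := zrk 0%N; rewrite addn0 rk0 => /(_ jl); rewrite /a rk0; lia.
have triple i : (i.+1 < j)%N -> (a i.+1 = a i.+2 + m \/ a i.+1 = a i + m)%N /\
    ~ (a i.+1 = a i.+2 + m /\ a i.+1 = a i + m)%N.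
  move=> ij; have il : (i.+2 < l)%N by lia.
  have [r [B [C [w [sq _ hw]]]]] := layer_exists (ltnW (ltnW il)).
  have [r' [B' [C' [w' [sq' _ hw']]]]] := layer_exists (ltnW il).
  have [r'' [B'' [C'' [w'' [sq'' _ hw'']]]]] := layer_exists il.
  have T := step_tensor charF0 m_odd rep cc (ltnW il) sq sq'.
  have N0 := step_neq0 charF0 m_odd rep cc (ltnW il) sq sq'.
  have T' := step_tensor charF0 m_odd rep cc il sq' sq''.
  have N0' := step_neq0 charF0 m_odd rep cc il sq' sq''.
  have comm k k' : (k <= m)%N -> (k' <= m)%N ->
      B'' *m x k *m C' *m (B' *m x k' *m C) = B'' *m x k' *m C' *m (B' *m x k *m C).
    move=> km km'; rewrite !(step_comp charF0 m_odd rep cc il sq sq' sq'') //.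
    have [c ->] := bracket k k' km km'.
    rewrite mulmxDr mulmxDl -scalemxAr -scalemxAl [X in c *: X](_ : _ = 0) ?scaler0 ?addr0 //.
    have [_ BW _ _ _] := sq''; have [_ _ _ TC _] := sq.
    have /submxP[D ->] : (B'' *m z <= s i)%MS; last by rewrite -mulmxA TC mulmx0.
    case: i ij il BW {TC T N0 T' N0' sq sq' sq'' hw hw' hw''} => [|i] ij il BW.
      have : (B'' <= kermx z)%MS.
        by apply: submx_trans BW (submx_trans _ jK); apply: (chain_mono cc) => //; lia.
      by move/sub_kermxP ->; rewrite sub0mx.
    have /andP[jz _] := zim 1%N (ltac:(lia)).
    have s1i : (s 1%N <= s i.+1)%MS by apply: (chain_mono cc) => //; lia.
    apply: submx_trans s1i; apply: submx_trans jz; apply: submxMr.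
    by apply: submx_trans BW _; apply: (chain_mono cc); lia.
  split.
    exact: (commuting_middle charF0 hw'' hw' hw T' T N0' N0 comm).
  exact: (commuting_not_peak charF0 hw'' hw' hw T' T N0' N0 comm m_odd).
apply: (@no_return_of_steps m j a m_odd) => [|i ij|i ij|i ij]; first by lia.
- have il : (i.+1 < l)%N by lia.
  have [r [B [C [w [sq _ hw]]]]] := layer_exists (ltnW il).
  have [r' [B' [C' [w' [sq' _ hw']]]]] := layer_exists il.
  have T := step_tensor charF0 m_odd rep cc il sq sq'.
  have N0 := step_neq0 charF0 m_odd rep cc il sq sq'.
  by have [p [pm E _ _]] := tensor_triangle charF0 hw' hw T N0; exists p.
- by have [] := triple i ij.
by have [] := triple i ij.
Qed.


End Final.

Lemma chain_of_uniserial (F : fieldType) d (acts : seq 'M[F]_d) l : uniserial_len acts l ->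
  exists s, composition_chain [seq A^T | A <- acts] s l.
Proof.
move=> [s [[s0 soc] sl minimal]].
have sub_stable U : submod acts U <-> acts_stable [seq A^T | A <- acts] U.
  split=> [sU|/allP sU A Aa]; last by apply: sU; apply: map_f.
  by apply/allP => _ /mapP[A Aa ->]; apply: sU.
have s00 : s 0%N = 0 by apply/eqP; rewrite -submx0; case/andP: s0.
exists s; split=> //.
- by rewrite -sub1mx; case/andP: sl.
- move=> [|i] il; last by have [/sub_stable] := minimal i il.
  by rewrite s00; apply/allP => A _; rewrite mul0mx.
- by move=> i il; have [_ /ltmxW] := minimal i il.
- by move=> i il; have [_ + _] := minimal i il; rewrite ltmxE => /andP[].
move=> U i + il; have [r] := ubnP (\rank U); elim: r U => // r IH U rU sU sLe nle.
apply/negPn/negP => nU; have [_ socU _] := soc i; have [_ _ minS] := minimal i il.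
have minU : minimal_over acts (s i) U.
  split; [exact/sub_stable|by rewrite ltmxE sLe|].
  move=> V /sub_stable sV sV1 VU; have [Vs|nVs] := boolP (V <= s i)%MS.
    by left; apply/andP.
  right; apply/andP; split=> //; have [//|nUV] := boolP (U <= V)%MS.
  case/negP: nU; apply: submx_trans (VU); apply: IH => //.
  by apply: leq_trans (rank_ltmx _) rU; rewrite ltmxE VU.
have [/andP[Us _]|/andP[_ sU1]] := minS U ((sub_stable U).2 sU) sLe (socU U minU).
  by rewrite Us in nle.
by rewrite sU1 in nU.
Qed.

Theorem theorem5p2 (F : fieldType) (charF0 : [pchar F] =i pred0)
    (n : nat) (hn : (1 <= n)%N) (l : nat) (hl : (3 < l)%N)
    (d : nat) (E H Fm : 'M[F]_d) (X : nat -> 'M[F]_d) (Z : 'M[F]_d) :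
  gmodule n E H Fm X Z ->
  gfaithful n E H Fm X Z ->
  ~ uniserial_len (gacts n E H Fm X Z) l.
Proof.
move=> [[HE HF EF] HX [EZ HZ FZ XZ] XX] faith /chain_of_uniserial[s cc].
set m := (2 * n).-1 in HX XX; have m2 : (2 * n)%N = m.+1 by rewrite prednK //; lia.
have om : odd m by have := congr1 odd m2; rewrite oddM /= => /esym/negbFE.
have tr (A B C : 'M[F]_d) : lie A B = C -> B^T *m A^T = A^T *m B^T + C^T.
  by move=> <-; rewrite /lie linearB /= !trmx_mul addrC subrK.
have tr0 A : lie A Z = 0 -> A^T *m Z^T = Z^T *m A^T by move/tr ->; rewrite trmx0 addr0.
have rep : heis_rep m E^T H^T Fm^T (fun k => (X k)^T) Z^T.
  split.
  - split; first by rewrite (tr _ _ _ HE) linearZ.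
      by rewrite (tr _ _ _ HF) linearN /= linearZ.
    by rewrite (tr _ _ _ EF).
  - move=> k km; have [|Hk Ek Fk] := HX k; first by rewrite m2.
    by split; rewrite (tr _ _ _ Hk, tr _ _ _ Ek, tr _ _ _ Fk) linearZ.
  - by move=> A; rewrite !inE => /or3P[] /eqP ->; apply: tr0.
  - by move=> k km; apply/tr0/XZ; rewrite m2.
  - by move=> i j im jm; rewrite (tr _ _ _ (XX i j _ _)) ?m2 // linearZ.
have {}cc : composition_chain (heis_acts m E^T H^T Fm^T (fun k => (X k)^T) Z^T) s l.
  have -> : heis_acts m E^T H^T Fm^T (fun k => (X k)^T) Z^T = [seq A^T | A <- gacts n E H Fm X Z].
    by rewrite /heis_acts /gacts m2 !map_cons -map_comp.
  exact: cc.
have Z0 : Z = 0 by apply: trmx_inj; rewrite trmx0; apply: (z0_of_length_gt3 charF0 om rep cc hl).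
have [|_ _ _ /eqP + _] := faith 0 0 0 1 (fun=> 0); last by rewrite oner_eq0.
rewrite Z0 !scale0r scaler0 !add0r addr0 big1 // => k _; exact: scale0r.
Qed.
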